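(* (i) $\mathsf{BIM}\vdash\mathbf{Dec}$-$\mathbf{BI}_{\mathcal C}$, where $\mathbf{Dec}$-$\mathbf{BI}_{\mathcal C}$ is: for every $\alpha$, if $D_\alpha$ is a bar in $\mathcal C$ and $\forall s\in Bin[s\in D_\alpha\leftrightarrow\forall i<2[s\ast\langle i\rangle\in D_\alpha]]$, then $\langle\rangle\in D_\alpha$. (ii) $\mathsf{BIM}\vdash\mathbf{\Sigma}^0_1$-$\mathbf{BI}_{\mathcal C}\leftrightarrow\mathbf{FT}$, where $\mathbf{\Sigma}^0_1$-$\mathbf{BI}_{\mathcal C}$ is: for every $\alpha$, if $E_\alpha$ is a bar in $\mathcal C$ and $\forall s\in Bin[s\in E_\alpha\leftrightarrow\forall i<2[s\ast\langle i\rangle\in E_\alpha]]$, then $\langle\rangle\in E_\alpha$; and $\mathbf{FT}$ (Fan Theorem) is: for every $\alpha$, if $D_\alpha$ is a bar in $\mathcal C$ then there is $n$ such that $D_{\overline\alpha n}$ is a bar in $\mathcal C$.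
   Context: $\mathsf{BIM}$ is the two-sorted intuitionistic theory of natural numbers and functions $\mathbb N\to\mathbb N$ with extensionality, primitive recursive constants, closure of functions under composition, primitive recursion and unbounded search, and full induction. Finite sequences are coded by naturals: $\langle\rangle=0$ the empty sequence, $length(a)$, entries $a(i)$, $s\ast t$ concatenation, $\overline\alpha n=\langle\alpha(0),\dots,\alpha(n-1)\rangle$. $Bin$ is the set of codes of finite 0-1 sequences; $\mathcal C=\{\alpha\mid\forall n[\alpha(n)<2]\}$. $D_\alpha=\{n\mid\alpha(n)\ne0\}$; for a code $a$, $D_a=\{i<length(a)\mid a(i)\ne0\}$; $E_\alpha=\{n\mid\exists p[\alpha(p)=n+1]\}$. A set $B\subseteq\mathbb N$ is a bar in $\mathcal C$ if $\forall\gamma\in\mathcal C\exists n[\overline\gamma n\in B]$. *)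

(* Defs.v *)
From Stdlib Require Import List.
From Stdlib Require Vector Fin.
Import Vector.VectorNotations.

Set Implicit Arguments.

(** * Primitive recursive function symbols

    [prf n] is the set of names of [n]-ary primitive recursive functions.
    Their defining equations are axioms of [BIM] below. In [Rec f g] the
    recursion variable comes first: [h(0,ts) = f(ts)] and
    [h(x+1,ts) = g(x,h(x,ts),ts)]. *)

Inductive prf : nat -> Set :=
| Zero : prf 0
| Succ : prf 1
| Proj : forall n, Fin.t n -> prf n
| Comp : forall m n, prf m -> Vector.t (prf n) m -> prf n
| Rec : forall n, prf n -> prf (S (S n)) -> prf (S n).

(** * Syntax

    Two-sorted de Bruijn syntax; numerical variables and function variables
    are indexed separately, so a numerical binder does not move the function
    indices and conversely. The function terms are the function variables
    and the unary constants. *)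

Inductive tm : Set :=
| Var : nat -> tm
| Con : forall n, prf n -> Vector.t tm n -> tm
| App : nat -> tm -> tm.   (* [App i t]: i-th function variable at [t] *)

Inductive fn : Set :=
| FVar : nat -> fn
| FCon : prf 1 -> fn.

Definition ap (F : fn) (t : tm) : tm :=
  match F with
  | FVar i => App i t
  | FCon f => Con f [t]
  end.

Inductive fm : Set :=
| Bot : fm
| Eq0 : tm -> tm -> fm
| Eq1 : fn -> fn -> fm
| And : fm -> fm -> fm
| Or : fm -> fm -> fm
| Imp : fm -> fm -> fm
| AllN : fm -> fm
| ExN : fm -> fm
| AllF : fm -> fm
| ExF : fm -> fm.

Declare Scope fm_scope.
Delimit Scope fm_scope with fm.
Bind Scope fm_scope with fm.
Open Scope fm_scope.

Notation "# i" := (Var i) (at level 1, format "# i") : fm_scope.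
Infix "==" := Eq0 (at level 70, no associativity) : fm_scope.
Infix "===" := Eq1 (at level 70, no associativity) : fm_scope.
Infix "//\" := And (at level 80, right associativity) : fm_scope.
Infix "\//" := Or (at level 85, right associativity) : fm_scope.
Infix "==>" := Imp (at level 90, right associativity) : fm_scope.
Notation "A <==> B" := (And (Imp A B) (Imp B A))
  (at level 95, no associativity) : fm_scope.

Definition Neg (A : fm) : fm := A ==> Bot.

(** * Substitution *)

Fixpoint ren_tm (r q : nat -> nat) (t : tm) : tm :=
  match t with
  | Var i => Var (r i)
  | Con f ts => Con f (Vector.map (ren_tm r q) ts)
  | App i t => App (q i) (ren_tm r q t)
  end.

Definition ren_fn (q : nat -> nat) (F : fn) : fn :=
  match F with
  | FVar i => FVar (q i)
  | FCon f => FCon f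
  end.

Fixpoint sub_tm (s : nat -> tm) (p : nat -> fn) (t : tm) : tm :=
  match t with
  | Var i => s i
  | Con f ts => Con f (Vector.map (sub_tm s p) ts)
  | App i t => ap (p i) (sub_tm s p t)
  end.

Definition sub_fn (p : nat -> fn) (F : fn) : fn :=
  match F with
  | FVar i => p i
  | FCon f => FCon f
  end.

Definition scons {X : Type} (x : X) (s : nat -> X) (i : nat) : X :=
  match i with
  | 0 => x
  | S j => s j
  end.

(* shift by one numerical, respectively one function variable *)
Definition shN : tm -> tm := ren_tm S (fun i => i).
Definition shF : tm -> tm := ren_tm (fun i => i) S.

Fixpoint sub (s : nat -> tm) (p : nat -> fn) (A : fm) : fm :=
  let sN := scons #0 (fun i => shN (s i)) in
  let sF := fun i => shF (s i) in
  let pF := scons (FVar 0) (fun i => ren_fn S (p i)) in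
  match A with
  | Bot => Bot
  | Eq0 t u => Eq0 (sub_tm s p t) (sub_tm s p u)
  | Eq1 F G => Eq1 (sub_fn p F) (sub_fn p G)
  | And A B => And (sub s p A) (sub s p B)
  | Or A B => Or (sub s p A) (sub s p B)
  | Imp A B => Imp (sub s p A) (sub s p B)
  | AllN A => AllN (sub sN p A)
  | ExN A => ExN (sub sN p A)
  | AllF A => AllF (sub sF pF A)
  | ExF A => ExF (sub sF pF A)
  end.

Definition instN (A : fm) (t : tm) : fm := sub (scons t Var) FVar A.
Definition instF (A : fm) (F : fn) : fm := sub Var (scons F FVar) A.
Definition wkN (A : fm) : fm := sub (fun i => Var (S i)) FVar A.
Definition wkF (A : fm) : fm := sub Var (fun i => FVar (S i)) A.

(** * Intuitionistic two-sorted logic with equality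

    Natural deduction from a set [T] of non-logical axioms. Free variables in
    an axiom are read as universally quantified: an axiom may be used in
    every context, including below the quantifier introductions. *)

Inductive prv (T : fm -> Prop) : list fm -> fm -> Prop :=
| prv_ax G A : T A -> prv T G A
| prv_hyp G A : List.In A G -> prv T G A
| prv_botE G A : prv T G Bot -> prv T G A
| prv_andI G A B : prv T G A -> prv T G B -> prv T G (A //\ B)
| prv_andE1 G A B : prv T G (A //\ B) -> prv T G A
| prv_andE2 G A B : prv T G (A //\ B) -> prv T G B
| prv_orI1 G A B : prv T G A -> prv T G (A \// B)
| prv_orI2 G A B : prv T G B -> prv T G (A \// B)
| prv_orE G A B C :
    prv T G (A \// B) ->
    prv T (A :: G)%list C -> prv T (B :: G)%list C -> prv T G C
| prv_impI G A B : prv T (A :: G)%list B -> prv T G (A ==> B)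
| prv_impE G A B : prv T G (A ==> B) -> prv T G A -> prv T G B
| prv_allNI G A : prv T (List.map wkN G) A -> prv T G (AllN A)
| prv_allNE G A t : prv T G (AllN A) -> prv T G (instN A t)
| prv_exNI G A t : prv T G (instN A t) -> prv T G (ExN A)
| prv_exNE G A C :
    prv T G (ExN A) -> prv T (A :: List.map wkN G)%list (wkN C) -> prv T G C
| prv_allFI G A : prv T (List.map wkF G) A -> prv T G (AllF A)
| prv_allFE G A F : prv T G (AllF A) -> prv T G (instF A F)
| prv_exFI G A F : prv T G (instF A F) -> prv T G (ExF A)
| prv_exFE G A C :
    prv T G (ExF A) -> prv T (A :: List.map wkF G)%list (wkF C) -> prv T G C
| prv_refl0 G t : prv T G (t == t)
| prv_leib0 G A t u :
    prv T G (t == u) -> prv T G (instN A t) -> prv T G (instN A u)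
| prv_refl1 G F : prv T G (F === F)
| prv_leib1 G A F H :
    prv T G (F === H) -> prv T G (instF A F) -> prv T G (instF A H).

Notation "T |-- A" := (prv T (@nil fm) A) (at level 99, no associativity).

(** * Some primitive recursive functions *)

Definition p0 {n} : prf (S n) := Proj Fin.F1.
Definition p1 {n} : prf (S (S n)) := Proj (Fin.FS Fin.F1).
Definition p2 {n} : prf (S (S (S n))) := Proj (Fin.FS (Fin.FS Fin.F1)).

Definition c1 {n} (f : prf 1) (g : prf n) : prf n := Comp f [g].
Definition c2 {n} (f : prf 2) (g h : prf n) : prf n := Comp f [g; h].

Definition zero_ {n} : prf n := @Comp 0 n Zero [].
Definition pred_ : prf 1 := Rec Zero p0.
Definition sg_ : prf 1 := Rec Zero (c1 Succ zero_).
Definition add_ : prf 2 := Rec p0 (c1 Succ p1).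
(* cut-off subtraction: [rsub_(x,y) = y - x], [monus_(x,y) = x - y] *)
Definition rsub_ : prf 2 := Rec p0 (c1 pred_ p1).
Definition monus_ : prf 2 := c2 rsub_ p1 p0.

(* Cantor pairing [J(m,n) = tri(m+n) + n] and its projections [K] and [L];
   [diag_ x] is the largest [w] such that [tri w <= x]. *)
Definition tri_ : prf 1 := Rec Zero (c1 Succ (c2 add_ p0 p1)).
Definition J_ : prf 2 := c2 add_ (c1 tri_ add_) p1.
Definition diag_ : prf 1 :=
  Rec Zero (c2 add_ p1
    (c2 monus_ (c1 Succ zero_)
               (c2 monus_ (c1 tri_ (c1 Succ p1)) (c1 Succ p0)))).
Definition L_ : prf 1 := c2 monus_ p0 (c1 tri_ diag_).
Definition K_ : prf 1 := c2 monus_ diag_ L_.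

(* Every natural number codes exactly one finite sequence:
   the empty sequence is [0] and [s * <i>] is [J(s,i) + 1]. *)
Definition snoc_ : prf 2 := c1 Succ J_.
Definition pop_ : prf 1 := Rec Zero (c1 K_ p0).
Definition top_ : prf 1 := Rec Zero (c1 L_ p0).
(* [pops_(n,s)]: [s] without its last [n] entries *)
Definition pops_ : prf 2 := Rec p0 (c1 pop_ p1).
(* [count_(n,s)]: the number of [k < n] such that [pops_(k,s)] is nonempty;
   as [length(s) <= s], it suffices to take [n = s] *)
Definition count_ : prf 2 :=
  Rec zero_ (c2 add_ p1 (c1 sg_ (c2 pops_ p0 p2))).
Definition len_ : prf 1 := c2 count_ p0 p0.
Definition entry_ : prf 2 :=
  c1 top_ (c2 pops_ (c2 monus_ (c1 len_ p0) (c1 Succ p1)) p0).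

Definition zero : tm := Con Zero [].
Definition succ (t : tm) : tm := Con Succ [t].
Definition two : tm := succ (succ zero).
Definition monus (t u : tm) : tm := Con monus_ [t; u].
Definition pair (t u : tm) : tm := Con J_ [t; u].
Definition snoc (t u : tm) : tm := Con snoc_ [t; u].
Definition len (t : tm) : tm := Con len_ [t].
Definition entry (t u : tm) : tm := Con entry_ [t; u].

(* [t < u] as [(t+1) - u = 0] *)
Definition lt (t u : tm) : fm := monus (succ t) u == zero.

(** * The axioms of BIM *)

Inductive BIM : fm -> Prop :=
(* for all a b, a = b <-> for all n, a(n) = b(n) *)
| bim_ext :
    BIM (AllF (AllF ((FVar 1 === FVar 0)
                     <==> AllN (App 1 #0 == App 0 #0))))
| bim_succ_neq0 : BIM (AllN (Neg (succ #0 == zero)))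
| bim_succ_inj : BIM (AllN (AllN ((succ #1 == succ #0) ==> (#1 == #0))))
| bim_proj n (i : Fin.t n) (ts : Vector.t tm n) :
    BIM (Con (Proj i) ts == Vector.nth ts i)
| bim_comp m n (f : prf m) (gs : Vector.t (prf n) m) (ts : Vector.t tm n) :
    BIM (Con (Comp f gs) ts == Con f (Vector.map (fun g => Con g ts) gs))
| bim_rec0 n (f : prf n) (g : prf (S (S n))) (ts : Vector.t tm n) :
    BIM (Con (Rec f g) (zero :: ts) == Con f ts)
| bim_recS n (f : prf n) (g : prf (S (S n))) (x : tm) (ts : Vector.t tm n) :
    BIM (Con (Rec f g) (succ x :: ts)
         == Con g (x :: Con (Rec f g) (x :: ts) :: ts))
(* for all a b there is c such that for all n, c(n) = a(b(n)) *)
| bim_fun_comp :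
    BIM (AllF (AllF (ExF (AllN (App 0 #0 == App 2 (App 1 #0))))))
(* for all a b there is c such that for all m n,
   c(m,0) = a(m) and c(m,n+1) = b(m,n,c(m,n)),
   where (m,n) = J(m,n) and (m,n,k) = J(J(m,n),k) *)
| bim_fun_rec :
    BIM (AllF (AllF (ExF (AllN (AllN (
      (App 0 (pair #1 zero) == App 2 #1) //\
      (App 0 (pair #1 (succ #0))
       == App 1 (pair (pair #1 #0) (App 0 (pair #1 #0))))))))))
(* for all a, if for all m there is n with a(m,n) = 0, then there is c such
   that for all m, a(m,c(m)) = 0 and a(m,n) <> 0 for all n < c(m) *)
| bim_fun_search :
    BIM (AllF (AllN (ExN (App 0 (pair #1 #0) == zero)) ==>
               ExF (AllN ((App 1 (pair #0 (App 0 #0)) == zero) //\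
                          AllN (lt #0 (App 0 #1) ==>
                                Neg (App 1 (pair #1 #0) == zero))))))
| bim_ind A :
    BIM (instN A zero
         //\ AllN (A ==> sub (scons (succ #0) (fun i => Var (S i))) FVar A)
         ==> AllN A).

(** * Bars in Cantor space

    A subset of the natural numbers is represented by a formula [B] in which
    [#0] stands for the element and [#(i+1)] for the variable that is [#i]
    outside. [elem d t B] says that [t] is in [B], written below [d]
    numerical quantifiers. *)

Definition elem (d : nat) (t : tm) (B : fm) : fm :=
  sub (scons t (fun i => Var (i + d))) FVar B.

(* [D_alpha], [D_a] and [E_alpha], where [alpha] is the [k]-th function
   variable and [a] a numerical term *)
Definition Dfun (k : nat) : fm := Neg (App k #0 == zero).
Definition Dcode (a : tm) : fm :=
  lt #0 (len (shN a)) //\ Neg (entry (shN a) #0 == zero).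
Definition Efun (k : nat) : fm := ExN (App k #0 == succ #1).

Definition inBin (s : tm) : fm :=
  AllN (lt #0 (len (shN s)) ==> lt (entry (shN s) #0) two).

Definition inC (F : fn) : fm := AllN (lt (ap F #0) two).

(* [c] is the code of the initial segment of [F] of length [n] *)
Definition isInit (F : fn) (n c : tm) : fm :=
  (len c == n) //\
  AllN (lt #0 (shN n) ==> (entry (shN c) #0 == ap F #0)).

Definition bar (B : fm) : fm :=
  AllF (inC (FVar 0) ==>
        ExN (ExN (isInit (FVar 0) #1 #0 //\ elem 2 #0 (wkF B)))).

(* for all s in Bin, s in B <-> for all i < 2, s * <i> in B *)
Definition hereditary (B : fm) : fm :=
  AllN (inBin #0 ==>
        (elem 1 #0 B <==> AllN (lt #0 two ==> elem 2 (snoc #1 #0) B))).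

Definition BarInd (B : fm) : fm :=
  bar B //\ hereditary B ==> elem 0 zero B.

Definition Dec_BI_C : fm := AllF (BarInd (Dfun 0)).

Definition Sigma01_BI_C : fm := AllF (BarInd (Efun 0)).

Definition FT : fm :=
  AllF (bar (Dfun 0) ==>
        ExN (ExN (isInit (FVar 0) #1 #0 //\ bar (Dcode #0)))).

(* Main.v *)
(** Derivations are built in the universal model: [sat G s p A] interprets [A] at the context
    [G], with terms as individuals, and holds exactly when [A] is derivable from [G]. There the
    quantifiers range over Coq objects, so the mathematics can be done with Coq variables.

    (i) If the empty sequence is not in the decidable bar, always moving to the first child
    outside the bar defines a path that avoids it.

    (ii) From the Fan Theorem: an enumerable bar [E_alpha] is replaced by the decidable bar of
    those [t] whose length codes a stage at which [alpha] enumerates an initial segment of [t];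
    a bound for the latter puts all sequences of some length in [E_alpha], and backward
    induction on the length reaches the empty sequence.
    Conversely, given a decidable bar [D_alpha], the set of [s] having only finitely many
    extensions without initial segment in [D_alpha] is enumerable, because a bound [n] for these
    extensions is checked on the [t < n]: the unbarred ones have both children below [n]. *)

From Stdlib Require Import List Lia.
From Stdlib Require Vector Fin Setoid Morphisms RelationClasses.
Require Import Defs.
Import ListNotations Vector.VectorNotations.

(** * Substitution *)

Lemma tm_nested_ind (P : tm -> Prop)
  (HV : forall i, P (Var i))
  (HC : forall n (f : prf n) ts, Vector.Forall P ts -> P (Con f ts))
  (HA : forall i t, P t -> P (App i t)) : forall t, P t.
Proof.
  fix IH 1. intros [i|n f ts|i t].
  - apply HV.
  - apply HC. clear f. induction ts as [|t n ts IHts].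
    + constructor.
    + constructor; [apply IH | exact IHts].
  - apply HA, IH.
Qed.

Lemma map_Forall_ext {A B} (f g : A -> B) n (v : Vector.t A n) :
  Vector.Forall (fun x => f x = g x) v -> Vector.map f v = Vector.map g v.
Proof. induction 1; cbn; congruence. Qed.

Lemma sub_tm_ext s s' p p' t :
  (forall i, s i = s' i) -> (forall i, p i = p' i) -> sub_tm s p t = sub_tm s' p' t.
Proof.
  intros Hs Hp. induction t using tm_nested_ind; cbn; auto.
  - f_equal. now apply map_Forall_ext.
  - now rewrite Hp, IHt.
Qed.

Lemma sub_fn_ext p p' F : (forall i, p i = p' i) -> sub_fn p F = sub_fn p' F.
Proof. destruct F; cbn; auto. Qed.

Lemma ren_tm_sub r q t :
  ren_tm r q t = sub_tm (fun i => Var (r i)) (fun i => FVar (q i)) t.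
Proof.
  induction t using tm_nested_ind; cbn; auto.
  - f_equal. now apply map_Forall_ext.
  - now rewrite IHt.
Qed.

Lemma ren_fn_sub q F : ren_fn q F = sub_fn (fun i => FVar (q i)) F.
Proof. destruct F; reflexivity. Qed.

Lemma sub_tm_ap s p F t : sub_tm s p (ap F t) = ap (sub_fn p F) (sub_tm s p t).
Proof. destruct F; reflexivity. Qed.

Lemma sub_tm_comp s p s' p' t :
  sub_tm s p (sub_tm s' p' t)
  = sub_tm (fun i => sub_tm s p (s' i)) (fun i => sub_fn p (p' i)) t.
Proof.
  induction t using tm_nested_ind; cbn; auto.
  - f_equal. rewrite Vector.map_map. now apply map_Forall_ext.
  - now rewrite sub_tm_ap, IHt.
Qed.

Lemma sub_fn_comp p p' F : sub_fn p (sub_fn p' F) = sub_fn (fun i => sub_fn p (p' i)) F.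
Proof. destruct F; reflexivity. Qed.

Lemma sub_tm_id t : sub_tm Var FVar t = t.
Proof.
  induction t using tm_nested_ind; cbn; auto.
  - f_equal. rewrite <- (Vector.map_id _ _ ts) at 2. now apply map_Forall_ext.
  - now rewrite IHt.
Qed.

Lemma sub_fn_id F : sub_fn FVar F = F.
Proof. destruct F; reflexivity. Qed.

(** [sub] writes these liftings inline; naming them gives the commutation lemmas a statement. *)
Definition upN (s : nat -> tm) : nat -> tm := scons #0 (fun i => shN (s i)).
Definition upF (p : nat -> fn) : nat -> fn := scons (FVar 0) (fun i => ren_fn S (p i)).

Lemma sub_ext A : forall s s' p p',
  (forall i, s i = s' i) -> (forall i, p i = p' i) -> sub s p A = sub s' p' A.
Proof.
  induction A; intros s s' p p' Hs Hp; cbn; f_equal; auto using sub_tm_ext, sub_fn_ext.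
  all: first [apply IHA | idtac]; auto; intros [|i]; cbn; congruence.
Qed.

Lemma sub_shN s p t : sub_tm s p (shN t) = sub_tm (fun i => s (S i)) p t.
Proof. unfold shN. rewrite ren_tm_sub, sub_tm_comp. now apply sub_tm_ext. Qed.

Lemma sub_shF s p t : sub_tm s p (shF t) = sub_tm s (fun i => p (S i)) t.
Proof. unfold shF. rewrite ren_tm_sub, sub_tm_comp. now apply sub_tm_ext. Qed.

Lemma shN_sub s p t : shN (sub_tm s p t) = sub_tm (fun i => shN (s i)) p t.
Proof.
  unfold shN. rewrite ren_tm_sub, sub_tm_comp. apply sub_tm_ext; intros i.
  - now rewrite ren_tm_sub.
  - now rewrite sub_fn_id.
Qed.

Lemma shF_sub s p t :
  shF (sub_tm s p t) = sub_tm (fun i => shF (s i)) (fun i => ren_fn S (p i)) t.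
Proof.
  unfold shF. rewrite ren_tm_sub, sub_tm_comp. apply sub_tm_ext; intros i.
  - now rewrite ren_tm_sub.
  - now rewrite ren_fn_sub.
Qed.

Lemma sub_comp A : forall s p s' p',
  sub s p (sub s' p' A)
  = sub (fun i => sub_tm s p (s' i)) (fun i => sub_fn p (p' i)) A.
Proof.
  induction A; intros s p s' p'; cbn; f_equal; auto using sub_tm_comp, sub_fn_comp.
  all: rewrite IHA; apply sub_ext; intros [|i]; cbn; auto.
  all: try (now rewrite sub_shN, shN_sub).
  all: try (now rewrite sub_shF, shF_sub).
  all: try (now destruct (p' i)).
Qed.

Lemma sub_id A : sub Var FVar A = A.
Proof.
  induction A; cbn; f_equal; auto using sub_tm_id, sub_fn_id.
  all: rewrite <- IHA at 2; apply sub_ext; intros [|i]; reflexivity.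
Qed.

Lemma sub_wkN s p A : sub s p (wkN A) = sub (fun i => s (S i)) p A.
Proof. unfold wkN. rewrite sub_comp. now apply sub_ext. Qed.

Lemma sub_wkF s p A : sub s p (wkF A) = sub s (fun i => p (S i)) A.
Proof. unfold wkF. rewrite sub_comp. now apply sub_ext. Qed.

Lemma sub_upN_wkN s p A : sub (upN s) p (wkN A) = wkN (sub s p A).
Proof.
  rewrite sub_wkN. unfold wkN. rewrite sub_comp. apply sub_ext; intros i; cbn.
  - unfold shN. now rewrite ren_tm_sub.
  - now rewrite sub_fn_id.
Qed.

Lemma sub_upF_wkF s p A :
  sub (fun i => shF (s i)) (upF p) (wkF A) = wkF (sub s p A).
Proof.
  rewrite sub_wkF. unfold wkF. rewrite sub_comp. apply sub_ext; intros i; cbn.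
  - unfold shF. now rewrite ren_tm_sub.
  - now rewrite ren_fn_sub.
Qed.

(** Links the syntactic instance in the quantifier rules with the extended environment [scons t s]
    by which [sat] reads a quantifier. *)
Lemma instN_sub s p A t : instN (sub (upN s) p A) t = sub (scons t s) p A.
Proof.
  unfold instN. rewrite sub_comp. apply sub_ext; intros i.
  - destruct i; cbn; auto. rewrite sub_shN. apply sub_tm_id.
  - apply sub_fn_id.
Qed.

Lemma instF_sub s p A F :
  instF (sub (fun i => shF (s i)) (upF p) A) F = sub s (scons F p) A.
Proof.
  unfold instF. rewrite sub_comp. apply sub_ext; intros i.
  - rewrite sub_shF. apply sub_tm_id.
  - destruct i; cbn; auto. destruct (p i); reflexivity.
Qed.

Lemma sub_instN s p A t : sub s p (instN A t) = sub (scons (sub_tm s p t) s) p A.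
Proof.
  unfold instN. rewrite sub_comp. apply sub_ext; auto. intros [|i]; reflexivity.
Qed.

Lemma sub_instF s p A F : sub s p (instF A F) = sub s (scons (sub_fn p F) p) A.
Proof.
  unfold instF. rewrite sub_comp. apply sub_ext; auto. intros [|i]; reflexivity.
Qed.

Lemma instN_wkN A t : instN (wkN A) t = A.
Proof. unfold instN. rewrite sub_wkN. apply sub_id. Qed.

Lemma instF_wkF A F : instF (wkF A) F = A.
Proof. unfold instF. rewrite sub_wkF. apply sub_id. Qed.

(** * Weakening, and closure of derivations under substitution *)

Lemma prv_weaken T G A : prv T G A -> forall G', incl G G' -> prv T G' A.
Proof.
  assert (C : forall B G G', @incl fm G G' -> incl (B :: G) (B :: G')).
  { intros. apply incl_cons; cbn; auto. now apply incl_tl. }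
  induction 1; intros G' Hi.
  - now apply prv_ax.
  - apply prv_hyp; auto.
  - apply prv_botE; auto.
  - apply prv_andI; auto.
  - eapply prv_andE1; eauto.
  - eapply prv_andE2; eauto.
  - apply prv_orI1; auto.
  - apply prv_orI2; auto.
  - eapply prv_orE; eauto.
  - apply prv_impI; auto.
  - eapply prv_impE; eauto.
  - apply prv_allNI; auto using incl_map.
  - apply prv_allNE; auto.
  - eapply prv_exNI; eauto.
  - eapply prv_exNE; eauto using incl_map.
  - apply prv_allFI; auto using incl_map.
  - apply prv_allFE; auto.
  - eapply prv_exFI; eauto.
  - eapply prv_exFE; eauto using incl_map.
  - apply prv_refl0.
  - eapply prv_leib0; eauto.
  - apply prv_refl1.
  - eapply prv_leib1; eauto.
Qed.

Lemma prv_sub T : (forall A, T A -> forall s p, T (sub s p A)) ->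
  forall G A, prv T G A -> forall s p, prv T (map (sub s p) G) (sub s p A).
Proof.
  intros HT.
  assert (MN : forall s p G, map (sub (upN s) p) (map wkN G) = map wkN (map (sub s p) G)).
  { intros. rewrite !map_map. apply map_ext. intros. apply sub_upN_wkN. }
  assert (MF : forall s p G, map (sub (fun i => shF (s i)) (upF p)) (map wkF G)
                             = map wkF (map (sub s p) G)).
  { intros. rewrite !map_map. apply map_ext. intros. apply sub_upF_wkF. }
  induction 1; intros s p.
  - apply prv_ax; auto.
  - apply prv_hyp. now apply in_map.
  - apply prv_botE; apply IHprv.
  - apply prv_andI; [apply IHprv1|apply IHprv2].
  - eapply prv_andE1; apply IHprv.
  - eapply prv_andE2; apply IHprv.
  - apply prv_orI1; apply IHprv.
  - apply prv_orI2; apply IHprv.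
  - eapply prv_orE; [apply IHprv1|apply IHprv2|apply IHprv3].
  - apply prv_impI; apply IHprv.
  - eapply prv_impE; [apply IHprv1|apply IHprv2].
  - apply prv_allNI. rewrite <- MN. apply IHprv.
  - rewrite sub_instN, <- instN_sub. apply prv_allNE, (IHprv s p).
  - apply prv_exNI with (sub_tm s p t). fold sub. specialize (IHprv s p).
    rewrite sub_instN, <- instN_sub in IHprv. exact IHprv.
  - eapply prv_exNE; [apply IHprv1|]. fold sub. specialize (IHprv2 (upN s) p).
    cbn in IHprv2. rewrite MN, sub_upN_wkN in IHprv2. exact IHprv2.
  - apply prv_allFI. rewrite <- MF. apply IHprv.
  - rewrite sub_instF, <- instF_sub. apply prv_allFE, (IHprv s p).
  - apply prv_exFI with (sub_fn p F). fold sub. specialize (IHprv s p).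
    rewrite sub_instF, <- instF_sub in IHprv. exact IHprv.
  - eapply prv_exFE; [apply IHprv1|]. fold sub.
    specialize (IHprv2 (fun i => shF (s i)) (upF p)).
    cbn in IHprv2. rewrite MF, sub_upF_wkF in IHprv2. exact IHprv2.
  - apply prv_refl0.
  - specialize (IHprv2 s p). rewrite sub_instN, <- instN_sub in *.
    eapply prv_leib0; [apply IHprv1|exact IHprv2].
  - apply prv_refl1.
  - specialize (IHprv2 s p). rewrite sub_instF, <- instF_sub in *.
    eapply prv_leib1; [apply IHprv1|exact IHprv2].
Qed.

(** Closed axioms do not change, and the schemata for function symbols allow arbitrary argument
    vectors. Induction is closed because lifting commutes with substituting the successor. *)
Lemma BIM_sub A : BIM A -> forall s p, BIM (sub s p A).
Proof.
  destruct 1; intros s p; try now constructor.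
  - cbn. replace (sub_tm s p (Vector.nth ts i))
      with (Vector.nth (Vector.map (sub_tm s p) ts) i) by now apply Vector.nth_map.
    apply bim_proj.
  - cbn. rewrite Vector.map_map. cbn. rewrite <- (Vector.map_map _ _ _
      (fun g => Con g (Vector.map (sub_tm s p) ts)) (fun x => x)).
    rewrite Vector.map_id. apply bim_comp.
  - cbn. fold (upN s). rewrite sub_instN. rewrite <- instN_sub.
    replace (sub (upN s) p (sub _ _ A))
      with (sub (scons (succ #0) (fun i => Var (S i))) FVar (sub (upN s) p A)).
    + apply bim_ind.
    + rewrite !sub_comp. apply sub_ext; intros i.
      * destruct i; cbn; auto. rewrite sub_shN. cbn. unfold shN. now rewrite ren_tm_sub.
      * apply sub_fn_id.
Qed.

(** * Fresh variables *)

(** [k] bounds the free variables of both sorts; the bound is expressed through the action of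
    substitutions. *)
Lemma sub_tm_support t : exists k, forall s s' p p',
  (forall i, i < k -> s i = s' i /\ p i = p' i) -> sub_tm s p t = sub_tm s' p' t.
Proof.
  induction t as [i|n f ts H|i t [k Hk]] using tm_nested_ind.
  - exists (S i). intros s s' p p' H. apply H. lia.
  - assert (exists k, forall s s' p p',
      (forall i, i < k -> s i = s' i /\ p i = p' i) ->
      Vector.map (sub_tm s p) ts = Vector.map (sub_tm s' p') ts) as [k Hk].
    { clear f. induction H as [|n t ts Ht H IH]; [now exists 0|].
      destruct Ht as [k Hk], IH as [k' Hk']. exists (max k k'). intros s s' p p' Hs. cbn. f_equal.
      - apply Hk. intros i Hi. apply Hs. lia.
      - apply Hk'. intros i Hi. apply Hs. lia. }
    exists k. intros s s' p p' Hs. cbn. f_equal. auto.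
  - exists (max (S i) k). intros s s' p p' Hs. cbn. f_equal.
    + apply Hs. lia.
    + apply Hk. intros j Hj. apply Hs. lia.
Qed.

Lemma sub_fn_support F : exists k, forall p p',
  (forall i, i < k -> p i = p' i) -> sub_fn p F = sub_fn p' F.
Proof.
  destruct F as [i|f]; [|now exists 0]. exists (S i). intros p p' H. apply H. lia.
Qed.

Lemma sub_support A : exists k, forall s s' p p',
  (forall i, i < k -> s i = s' i /\ p i = p' i) -> sub s p A = sub s' p' A.
Proof.
  assert (B : forall A B : fm, forall k k',
    (forall s s' p p', (forall i, i < k -> s i = s' i /\ p i = p' i) ->
      sub s p A = sub s' p' A) ->
    (forall s s' p p', (forall i, i < k' -> s i = s' i /\ p i = p' i) ->
      sub s p B = sub s' p' B) ->
    forall s s' p p', (forall i, i < max k k' -> s i = s' i /\ p i = p' i) ->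
      sub s p A = sub s' p' A /\ sub s p B = sub s' p' B).
  { intros A0 B0 k k' H H' s s' p p' Hs. split; [apply H|apply H'];
      intros i Hi; apply Hs; lia. }
  induction A as [|t u|F H|A [k Hk] A' [k' Hk']|A [k Hk] A' [k' Hk']
                 |A [k Hk] A' [k' Hk']|A [k Hk]|A [k Hk]|A [k Hk]|A [k Hk]].
  - now exists 0.
  - destruct (sub_tm_support t) as [k Hk], (sub_tm_support u) as [k' Hk'].
    exists (max k k'). intros s s' p p' Hs. cbn. f_equal; [apply Hk|apply Hk'];
      intros i Hi; apply Hs; lia.
  - destruct (sub_fn_support F) as [k Hk], (sub_fn_support H) as [k' Hk'].
    exists (max k k'). intros s s' p p' Hs. cbn. f_equal; [apply Hk|apply Hk'];
      intros i Hi; apply Hs; lia.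
  - exists (max k k'). intros. cbn. f_equal; apply (B A A' k k'); auto.
  - exists (max k k'). intros. cbn. f_equal; apply (B A A' k k'); auto.
  - exists (max k k'). intros. cbn. f_equal; apply (B A A' k k'); auto.
  - exists k. intros s s' p p' H. cbn. f_equal. apply Hk. intros [|i] Hi; cbn.
    + split; auto. now apply H.
    + split; [f_equal|]; apply H; lia.
  - exists k. intros s s' p p' H. cbn. f_equal. apply Hk. intros [|i] Hi; cbn.
    + split; auto. now apply H.
    + split; [f_equal|]; apply H; lia.
  - exists k. intros s s' p p' H. cbn. f_equal. apply Hk. intros i Hi; cbn.
    split; [f_equal; now apply H|]. destruct i; cbn; auto. f_equal. apply H; lia.
  - exists k. intros s s' p p' H. cbn. f_equal. apply Hk. intros i Hi; cbn.
    split; [f_equal; now apply H|]. destruct i; cbn; auto. f_equal. apply H; lia.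
Qed.

Lemma map_sub_support G : exists k, forall s s' p p',
  (forall i, i < k -> s i = s' i /\ p i = p' i) -> map (sub s p) G = map (sub s' p') G.
Proof.
  induction G as [|A G [k Hk]]; [now exists 0|].
  destruct (sub_support A) as [k' Hk']. exists (max k k').
  intros s s' p p' H. cbn. f_equal; [apply Hk'|apply Hk]; intros i Hi; apply H; lia.
Qed.

(** The generic individual is a variable [x] beyond the supports of [G] and [A]. Renaming it to [#0]
    and shifting the others turns the derivation of this instance into the premise of the
    introduction rule. *)
Lemma prv_allN G A : (forall t, prv BIM G (instN A t)) -> prv BIM G (AllN A).
Proof.
  intros H. destruct (map_sub_support G) as [k Hk], (sub_support A) as [k' Hk'].
  set (x := max k k'). set (s := fun i => if Nat.eqb i x then #0 else Var (S i)).
  assert (Hs : forall i, i < x -> s i = Var (S i)).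
  { intros i Hi. unfold s. now rewrite (proj2 (PeanoNat.Nat.eqb_neq i x)) by lia. }
  apply prv_allNI. specialize (H (Var x)).
  apply (prv_sub BIM BIM_sub) with (s := s) (p := FVar) in H.
  replace (map (sub s FVar) G) with (map wkN G) in H.
  - rewrite sub_instN in H. rewrite <- (sub_id A). erewrite Hk'; [exact H|].
    intros [|i] Hi; cbn; split; auto.
    + unfold s. now rewrite PeanoNat.Nat.eqb_refl.
    + symmetry. apply Hs. lia.
  - apply Hk. intros i Hi. split; auto. symmetry. apply Hs. lia.
Qed.

Lemma prv_allF G A : (forall F, prv BIM G (instF A F)) -> prv BIM G (AllF A).
Proof.
  intros H. destruct (map_sub_support G) as [k Hk], (sub_support A) as [k' Hk'].
  set (x := max k k').
  set (p := fun i => if Nat.eqb i x then FVar 0 else FVar (S i)).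
  assert (Hs : forall i, i < x -> p i = FVar (S i)).
  { intros i Hi. unfold p. now rewrite (proj2 (PeanoNat.Nat.eqb_neq i x)) by lia. }
  apply prv_allFI. specialize (H (FVar x)).
  apply (prv_sub BIM BIM_sub) with (s := Var) (p := p) in H.
  replace (map (sub Var p) G) with (map wkF G) in H.
  - rewrite sub_instF in H. rewrite <- (sub_id A). erewrite Hk'; [exact H|].
    intros [|i] Hi; cbn; split; auto.
    + unfold p. now rewrite PeanoNat.Nat.eqb_refl.
    + symmetry. apply Hs. lia.
  - apply Hk. intros i Hi. split; auto. symmetry. apply Hs. lia.
Qed.

(** * Rules whose premises range over larger contexts *)

Lemma prv_imp G A B : (forall G', incl G G' -> prv BIM G' A -> prv BIM G' B) ->
  prv BIM G (A ==> B).
Proof.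
  intros H. apply prv_impI, H; [now apply incl_tl, incl_refl|].
  apply prv_hyp. now left.
Qed.

Lemma prv_or G A B C : prv BIM G (A \// B) ->
  (forall G', incl G G' -> prv BIM G' A -> prv BIM G' C) ->
  (forall G', incl G G' -> prv BIM G' B -> prv BIM G' C) -> prv BIM G C.
Proof.
  intros H HA HB. eapply prv_orE; [exact H|apply HA|apply HB];
    try (now apply incl_tl, incl_refl); apply prv_hyp; now left.
Qed.

(** The premise is internalised as the universal closure of [A ==> wkN C], because the elimination
    rule works in a shifted context. Shifting that formula and instantiating it at [#0] gives what
    the rule asks for. *)
Lemma prv_exN G A C : prv BIM G (ExN A) ->
  (forall t G', incl G G' -> prv BIM G' (instN A t) -> prv BIM G' C) -> prv BIM G C.
Proof.
  intros H HC. assert (K : prv BIM G (AllN (A ==> wkN C))).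
  { apply prv_allN. intros t. change (instN (A ==> wkN C) t)
      with (instN A t ==> instN (wkN C) t). rewrite instN_wkN.
    apply prv_imp. intros G' Hi. now apply HC. }
  eapply prv_exNE; [exact H|].
  apply (prv_sub BIM BIM_sub) with (s := fun i => Var (S i)) (p := FVar) in K.
  apply prv_weaken with (G' := (A :: map wkN G)%list) in K; [|now apply incl_tl, incl_refl].
  apply (prv_allNE (A := sub (upN (fun i => Var (S i))) FVar (A ==> wkN C)))
    with (t := #0) in K.
  rewrite instN_sub in K.
  eapply prv_impE.
  - rewrite <- (sub_id (A ==> wkN C)). erewrite sub_ext; [apply K| |reflexivity].
    intros [|i]; reflexivity.
  - apply prv_hyp. now left.
Qed.

Lemma prv_exF G A C : prv BIM G (ExF A) ->
  (forall F G', incl G G' -> prv BIM G' (instF A F) -> prv BIM G' C) -> prv BIM G C.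
Proof.
  intros H HC. assert (K : prv BIM G (AllF (A ==> wkF C))).
  { apply prv_allF. intros F. change (instF (A ==> wkF C) F)
      with (instF A F ==> instF (wkF C) F). rewrite instF_wkF.
    apply prv_imp. intros G' Hi. now apply HC. }
  eapply prv_exFE; [exact H|].
  apply (prv_sub BIM BIM_sub) with (s := Var) (p := fun i => FVar (S i)) in K.
  apply prv_weaken with (G' := (A :: map wkF G)%list) in K; [|now apply incl_tl, incl_refl].
  apply (prv_allFE (A := sub (fun i => shF (Var i)) (upF (fun i => FVar (S i)))
                             (A ==> wkF C))) with (F := FVar 0) in K.
  rewrite instF_sub in K.
  eapply prv_impE.
  - rewrite <- (sub_id (A ==> wkF C)). erewrite sub_ext; [apply K|reflexivity|].
    intros [|i]; reflexivity.
  - apply prv_hyp. now left.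
Qed.

(** * The universal model *)

Notation ctx := (list fm).

(* Disjunction and existence in continuation form: they can be opened only below a formula.
   The quantification over [G'] makes [Box] monotone for every [P]. *)
Definition Box (G : ctx) (P : ctx -> Prop) : Prop :=
  forall G' C, incl G G' ->
    (forall G'', incl G' G'' -> P G'' -> prv BIM G'' C) -> prv BIM G' C.

Definition eqv (G : ctx) (a b : tm) : Prop := prv BIM G (a == b).

(* The domains are constant: as every context leaves infinitely many variables free, a fresh
   variable serves as a generic individual without passing to another world. *)
Fixpoint sat (G : ctx) (s : nat -> tm) (p : nat -> fn) (A : fm) : Prop :=
  match A with
  | Bot => prv BIM G Bot
  | Eq0 t u => eqv G (sub_tm s p t) (sub_tm s p u)
  | Eq1 F H => prv BIM G (sub_fn p F === sub_fn p H)
  | And A B => sat G s p A /\ sat G s p B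
  | Or A B => Box G (fun G => sat G s p A \/ sat G s p B)
  | Imp A B => forall G', incl G G' -> sat G' s p A -> sat G' s p B
  | AllN A => forall t, sat G (scons t s) p A
  | ExN A => Box G (fun G => exists t, sat G (scons t s) p A)
  | AllF A => forall F, sat G s (scons F p) A
  | ExF A => Box G (fun G => exists F, sat G s (scons F p) A)
  end.

(** Each clause of [sat] matches one of the rules above. For disjunction and existence, the [Box] is
    applied to the formula itself in one direction, and in the other it is the elimination rule with
    its conclusion left open. *)
Lemma sat_prv A : forall G s p, sat G s p A <-> prv BIM G (sub s p A).
Proof.
  induction A; intros G s p; cbn [sat sub].
  1-3: reflexivity.
  - rewrite IHA1, IHA2. split.
    + intros []. now apply prv_andI.
    + intros H. split; [eapply prv_andE1|eapply prv_andE2]; exact H.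
  - split.
    + intros H. apply H; [apply incl_refl|]. intros G' _ [K|K].
      * apply prv_orI1. now apply IHA1.
      * apply prv_orI2. now apply IHA2.
    + intros H G' C Hi HC. eapply prv_or; [eapply prv_weaken; eauto| |];
        intros G'' Hi' K; apply HC; auto; [left; now apply IHA1|right; now apply IHA2].
  - split.
    + intros H. apply prv_imp. intros G' Hi K. apply IHA2, H, IHA1; auto.
    + intros H G' Hi K. apply IHA2. apply IHA1 in K.
      eapply prv_impE; [eapply prv_weaken|]; eauto.
  - split.
    + intros H. apply prv_allN. intros t. fold (upN s). rewrite instN_sub. now apply IHA.
    + intros H t. apply IHA. rewrite <- instN_sub. now apply prv_allNE.
  - split.
    + intros H. apply H; [apply incl_refl|]. intros G' _ [t K].
      apply prv_exNI with t. fold (upN s). rewrite instN_sub. now apply IHA.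
    + intros H G' C Hi HC. eapply prv_exN; [eapply prv_weaken; eauto|].
      intros t G'' Hi' K. apply HC; auto. exists t. apply IHA. rewrite <- instN_sub. exact K.
  - split.
    + intros H. apply prv_allF. intros F. fold (upF p). rewrite instF_sub. now apply IHA.
    + intros H F. apply IHA. rewrite <- instF_sub. now apply prv_allFE.
  - split.
    + intros H. apply H; [apply incl_refl|]. intros G' _ [F K].
      apply prv_exFI with F. fold (upF p). rewrite instF_sub. now apply IHA.
    + intros H G' C Hi HC. eapply prv_exF; [eapply prv_weaken; eauto|].
      intros F G'' Hi' K. apply HC; auto. exists F. apply IHA. rewrite <- instF_sub. exact K.
Qed.

Lemma sat_closed A G : sat G Var FVar A <-> prv BIM G A.
Proof. rewrite sat_prv. now rewrite sub_id. Qed.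

Lemma bim_sat A G : BIM A -> sat G Var FVar A.
Proof. intros H. now apply sat_closed, prv_ax. Qed.

(** * Monotonicity *)

Definition Mono (P : ctx -> Prop) := forall G G', incl G G' -> P G -> P G'.

Lemma mono_const P : Mono (fun _ => P).
Proof. easy. Qed.
Lemma mono_prv A : Mono (fun G => prv BIM G A).
Proof. intros G G' H K. eapply prv_weaken; eauto. Qed.
Lemma mono_eqv a b : Mono (fun G => eqv G a b).
Proof. apply mono_prv. Qed.
Lemma mono_sat s p A : Mono (fun G => sat G s p A).
Proof. intros G G' H. rewrite !sat_prv. now apply mono_prv. Qed.
Lemma mono_all {X} (P : X -> ctx -> Prop) :
  (forall x, Mono (P x)) -> Mono (fun G => forall x, P x G).
Proof. intros H G G' Hi K x. eapply H; eauto. Qed.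
Lemma mono_ex {X} (P : X -> ctx -> Prop) :
  (forall x, Mono (P x)) -> Mono (fun G => exists x, P x G).
Proof. intros H G G' Hi [x K]. exists x. eapply H; eauto. Qed.
Lemma mono_and P Q : Mono P -> Mono Q -> Mono (fun G => P G /\ Q G).
Proof. intros H H' G G' Hi []. split; eauto. Qed.
Lemma mono_or P Q : Mono P -> Mono Q -> Mono (fun G => P G \/ Q G).
Proof. intros H H' G G' Hi []; eauto. Qed.
Lemma mono_later (P : ctx -> Prop) : Mono (fun G => forall G', incl G G' -> P G').
Proof. intros G G' Hi H G'' Hi'. apply H. eapply incl_tran; eauto. Qed.
Lemma mono_incl G0 : Mono (fun G => incl G0 G).
Proof. intros G G' H K. eapply incl_tran; eauto. Qed.
Lemma mono_box P : Mono (fun G => Box G P).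
Proof. intros G G' H K G'' C Hi. apply K. eapply incl_tran; eauto. Qed.

Lemma mono_Forall2 {X Y} (R : ctx -> X -> Y -> Prop) n (v : Vector.t X n) w :
  (forall x y, Mono (fun G => R G x y)) -> Mono (fun G => Vector.Forall2 (R G) v w).
Proof. intros H G G' Hi. induction 1; constructor; auto. eapply H; eauto. Qed.

Ltac mono_step :=
  first [ apply mono_prv | apply mono_eqv | apply mono_sat | apply mono_incl
        | apply mono_box | apply mono_later
        | apply mono_and | apply mono_or
        | apply mono_ex; intros ? | apply mono_all; intros ?
        | apply mono_Forall2; intros ? ?
        | apply mono_const ].
Ltac mono := repeat mono_step.

Ltac lift1 Hi H :=
  match type of Hi with
  | incl ?G ?G' =>
      let T := type of H in
      match eval pattern G in T with
      | ?P _ =>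
          let M := fresh "M" in
          assert (M : Mono P) by (mono; fail);
          let H' := fresh "K" in
          pose proof (M _ _ Hi H) as H'; cbv beta in H';
          clear H; clear M; rename H' into H
      end
  end.
(* [lift Hi]: move all hypotheses along [Hi : incl G G'] and rename [G'] to [G] *)
Ltac lift Hi :=
  match type of Hi with
  | incl ?G ?G' =>
      repeat match goal with
        | H : context [G] |- _ => tryif constr_eq H Hi then fail else lift1 Hi H
        end;
      clear Hi; clear G; rename G' into G
  end.

(** [Box] is used as a continuation monad, left by [box_elim] only towards derivability of a
    formula. *)
Lemma box_ret (P : ctx -> Prop) G : P G -> Mono P -> Box G P.
Proof. intros H M G' C Hi K. apply K; [apply incl_refl|]. eapply M; eauto. Qed.

Lemma box_bind G P Q :
  Box G P -> (forall G', incl G G' -> P G' -> Box G' Q) -> Box G Q.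
Proof.
  intros H K G' C Hi HC. apply H; auto. intros G'' Hi' HP.
  apply (K G''); auto using incl_refl.
  - eapply incl_tran; eauto.
  - intros. apply HC; auto. eapply incl_tran; eauto.
Qed.

Lemma box_map G P Q : Box G P -> (forall G', P G' -> Q G') -> Box G Q.
Proof. intros H K G' C Hi HC. apply H; auto. Qed.

Lemma box_elim G P C :
  Box G P -> (forall G', incl G G' -> P G' -> prv BIM G' C) -> prv BIM G C.
Proof. intros H. apply H. apply incl_refl. Qed.

Ltac ret := apply box_ret; [|mono; fail].

(* [open H as pat]: use [H : Box G P] to prove a goal at [G] *)
Ltac open_ H :=
  first [ refine (box_bind _ _ _ H _) | refine (box_elim _ _ _ H _) ];
  try (is_var H; clear H).
Tactic Notation "open" constr(H) "as" simple_intropattern(pat) :=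
  open_ H; let G' := fresh "G'" in let Hi := fresh "Hi" in
  intros G' Hi; cbv beta; intros pat; lift Hi;
  try match goal with |- prv BIM ?G (Eq0 ?a ?b) => change (eqv G a b) end.
(* pass to a later world, keeping its name *)
Tactic Notation "world" :=
  let G' := fresh "G'" in let Hi := fresh "Hi" in
  intros G' Hi; lift Hi.

(** * Equality *)

Lemma eqv_leib G A s p a b :
  eqv G a b -> sat G (scons a s) p A -> sat G (scons b s) p A.
Proof.
  rewrite !sat_prv, <- !instN_sub. apply prv_leib0.
Qed.

#[export] Instance eqv_equiv G : RelationClasses.Equivalence (eqv G).
Proof.
  assert (R : RelationClasses.Reflexive (eqv G)) by (intros a; apply prv_refl0).
  assert (S : RelationClasses.Symmetric (eqv G)).
  { intros a b H. apply (eqv_leib G (#0 == #1) (scons a Var) FVar a b H). cbn. apply R. }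
  split; auto. intros a b c H H'.
  apply (eqv_leib G (#1 == #0) (scons a Var) FVar b c H' H).
Qed.

#[export] Instance ap_proper G F : Morphisms.Proper (Morphisms.respectful (eqv G) (eqv G)) (ap F).
Proof.
  intros a b H.
  pose proof (eqv_leib G (ap (FVar 0) #1 == ap (FVar 0) #0)
    (scons a Var) (scons F FVar) a b H) as K. cbn in K. apply K. reflexivity.
Qed.

(* Entries are replaced one at a time; [K'] is [K] with its parameters shifted. *)
Lemma veq_cong G n (v w : Vector.t tm n) : Vector.Forall2 (eqv G) v w ->
  forall K K' : Vector.t tm n -> tm,
  (forall v t, sub_tm (scons t Var) FVar (K' v)
               = K (Vector.map (sub_tm (scons t Var) FVar) v)) ->
  eqv G (K v) (K w).
Proof.
  assert (E : forall n t (v : Vector.t tm n),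
    Vector.map (sub_tm (scons t Var) FVar) (Vector.map shN v) = v).
  { intros m t u. rewrite Vector.map_map. rewrite <- (Vector.map_id _ _ u) at 2.
    apply Vector.map_ext. intros a. rewrite sub_shN. apply sub_tm_id. }
  induction 1 as [|n a b v w Hab H IH]; intros K K' HK; [reflexivity|].
  transitivity (K (b :: v)).
  - pose proof (eqv_leib G
      (shN (K (a :: v)) == K' (#0 :: Vector.map shN v)) Var FVar a b Hab) as L.
    cbn in L. rewrite !sub_shN, !sub_tm_id, !HK in L. cbn in L. rewrite !E in L.
    apply L. reflexivity.
  - apply (IH (fun v => K (b :: v)) (fun v => K' (shN b :: v))).
    intros u t. rewrite HK. cbn. now rewrite sub_shN, sub_tm_id.
Qed.

Lemma con_cong G n (f : prf n) v w : Vector.Forall2 (eqv G) v w -> eqv G (Con f v) (Con f w).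
Proof. intros H. now apply (veq_cong G n v w H (Con f) (Con f)). Qed.

(* [Con] on explicit argument lists, as constants that setoid rewriting can traverse *)
Definition C1 (f : prf 1) a := Con f [a].
Definition C2 (f : prf 2) a b := Con f [a; b].

#[export] Instance C1_proper f G : Morphisms.Proper (Morphisms.respectful (eqv G) (eqv G)) (C1 f).
Proof. intros a b H. apply con_cong. repeat (apply Vector.Forall2_cons; [assumption|]).
  apply Vector.Forall2_nil. Qed.
#[export] Instance C2_proper f G :
  Morphisms.Proper
    (Morphisms.respectful (eqv G) (Morphisms.respectful (eqv G) (eqv G))) (C2 f).
Proof. intros a b H c d H'. apply con_cong. repeat (apply Vector.Forall2_cons; [assumption|]).
  apply Vector.Forall2_nil. Qed.

(** * Evaluation of function symbols *)

(** Evaluation stops at [Rec], whose equations depend on the shape of the first argument. Equations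
    by composition and projection thus become computation in Rocq. *)
Fixpoint ev {n} (f : prf n) : Vector.t tm n -> tm :=
  match f in prf n return Vector.t tm n -> tm with
  | Zero => Con Zero
  | Succ => Con Succ
  | Proj i => fun ts => Vector.nth ts i
  | Comp f gs => fun ts => ev f (Vector.map (fun g => ev g ts) gs)
  | Rec f g => Con (Rec f g)
  end.

Fixpoint evt (t : tm) : tm :=
  match t with
  | Var i => Var i
  | Con f ts => ev f (Vector.map evt ts)
  | App i t => App i (evt t)
  end.

Lemma prf_nested_ind (P : forall n, prf n -> Prop)
  (HZ : P 0 Zero) (HS : P 1 Succ) (HP : forall n i, P n (Proj i))
  (HC : forall m n f gs, P m f -> Vector.Forall (P n) gs -> P n (@Comp m n f gs))
  (HR : forall n f g, P n f -> P (S (S n)) g -> P (S n) (Rec f g)) :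
  forall n f, P n f.
Proof.
  fix IH 2. intros n0 [| |m i|m n f gs|m f g].
  - apply HZ.
  - apply HS.
  - apply HP.
  - apply HC; [apply IH|]. clear f. induction gs as [|g k gs IHgs].
    + constructor.
    + constructor; [apply IH|exact IHgs].
  - apply HR; apply IH.
Qed.

Lemma ev_eqv G n (f : prf n) ts : eqv G (Con f ts) (ev f ts).
Proof.
  revert ts. induction f as [| |n i|m n f gs IHf IHg|n f g IHf IHg] using prf_nested_ind;
    intros ts; cbn; try reflexivity.
  - apply prv_ax, bim_proj.
  - transitivity (Con f (Vector.map (fun g => Con g ts) gs)); [apply prv_ax, bim_comp|].
    rewrite <- IHf. apply con_cong. clear f IHf.
    induction IHg; cbn; constructor; auto.
Qed.

Lemma evt_eqv G t : eqv G t (evt t).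
Proof.
  induction t as [i|n f ts H|i t IH] using tm_nested_ind; cbn; try reflexivity.
  - rewrite <- ev_eqv. apply con_cong. clear f. induction H; cbn; constructor; auto.
  - apply (ap_proper G (FVar i) _ _ IH).
Qed.

Lemma by_evt G t u : evt t = evt u -> eqv G t u.
Proof. intros H. rewrite (evt_eqv G t), (evt_eqv G u), H. reflexivity. Qed.

Lemma rec0 G n (f : prf n) g ts : eqv G (Con (Rec f g) (zero :: ts)) (ev f ts).
Proof. etransitivity; [apply prv_ax, bim_rec0|]. apply ev_eqv. Qed.
Lemma recS G n (f : prf n) g x ts :
  eqv G (Con (Rec f g) (succ x :: ts)) (ev g (x :: Con (Rec f g) (x :: ts) :: ts)).
Proof. etransitivity; [apply prv_ax, bim_recS|]. apply ev_eqv. Qed.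

(** * Definable predicates and induction *)

(** A Rocq function on terms could inspect their syntax. Only functions given by substitution into
    one fixed term have a counterpart in the theory, as induction and function existence require. *)
Definition DefT (f : tm -> tm) := exists t, forall x, sub_tm (scons x Var) FVar t = f x.

Lemma DefT_id : DefT (fun x => x).
Proof. now exists #0. Qed.
Lemma DefT_const c : DefT (fun _ => c).
Proof. exists (shN c). intros. rewrite sub_shN. apply sub_tm_id. Qed.
Lemma DefT_C1 g f : DefT f -> DefT (fun x => C1 g (f x)).
Proof. intros [t H]. exists (C1 g t). intros. cbn. now rewrite H. Qed.
Lemma DefT_C2 h f g : DefT f -> DefT g -> DefT (fun x => C2 h (f x) (g x)).
Proof. intros [t H] [u K]. exists (C2 h t u). intros. cbn. now rewrite H, K. Qed.
Lemma DefT_ap F f : DefT f -> DefT (fun x => ap F (f x)).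
Proof.
  intros [t H]. exists (ap F t). intros. rewrite sub_tm_ap, H. now rewrite sub_fn_id.
Qed.

Definition DefP (P : tm -> ctx -> Prop) :=
  exists A, forall x G, sat G (scons x Var) FVar A <-> P x G.

(** The parameters [s] and [p] are absorbed into the formula by substituting under the binder. *)
Lemma DefP_sat A s p (P : tm -> ctx -> Prop) :
  (forall x G, sat G (scons x s) p A <-> P x G) -> DefP P.
Proof.
  intros H. exists (sub (upN s) p A). intros x G. rewrite <- H, !sat_prv.
  change (sub (scons x Var) FVar ?B) with (instN B x). now rewrite instN_sub.
Qed.
Lemma DefP_const C : DefP (fun _ G => prv BIM G C).
Proof.
  exists (wkN C). intros x G. rewrite sat_prv.
  change (sub (scons x Var) FVar ?B) with (instN B x). now rewrite instN_wkN.
Qed.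
Lemma DefP_eqv f g : DefT f -> DefT g -> DefP (fun x G => eqv G (f x) (g x)).
Proof. intros [t H] [u K]. exists (t == u). intros. cbn. now rewrite H, K. Qed.
Lemma DefP_and P Q : DefP P -> DefP Q -> DefP (fun x G => P x G /\ Q x G).
Proof. intros [A H] [B K]. exists (A //\ B). intros. cbn. now rewrite H, K. Qed.
Lemma DefP_or P Q :
  DefP P -> DefP Q -> DefP (fun x G => Box G (fun G => P x G \/ Q x G)).
Proof.
  intros [A H] [B K]. exists (A \// B). intros. cbn.
  split; intros L; refine (box_map _ _ _ L _); intros G'; rewrite H, K; auto.
Qed.
Lemma DefP_imp P Q : DefP P -> DefP Q ->
  DefP (fun x G => forall G', incl G G' -> P x G' -> Q x G').
Proof.
  intros [A H] [B K]. exists (A ==> B). intros. cbn.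
  split; intros L G' Hi; specialize (L G' Hi); now rewrite H, K in *.
Qed.

Ltac defT := repeat first
  [ apply DefT_const | apply DefT_id | apply DefT_C2 | apply DefT_C1 | apply DefT_ap ].
Ltac defP := repeat first
  [ apply DefP_const | apply DefP_eqv; [defT; fail|defT; fail] | apply DefP_and
  | apply DefP_or | apply DefP_imp ].

Lemma bim_induction P G : DefP P -> P zero G ->
  (forall G' x, incl G G' -> P x G' -> P (succ x) G') -> forall x, P x G.
Proof.
  intros [A HA] H0 HS. pose proof (prv_ax BIM G _ (bim_ind A)) as K.
  assert (L : prv BIM G (AllN A)).
  { eapply prv_impE; [exact K|]. apply prv_andI.
    - apply HA, sat_prv in H0. exact H0.
    - apply prv_allN. intros t. unfold instN. cbn. apply prv_imp. intros G' Hi M.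
      apply sat_prv, HA, (HS G' t Hi), HA, sat_prv in M.
      rewrite sub_comp. erewrite sub_ext; [exact M| |reflexivity].
      intros [|i]; reflexivity. }
  intros x. apply HA, sat_prv. now apply prv_allNE.
Qed.

(* induction on [x] for a goal at world [G] *)
Ltac induct x :=
  match goal with G : list fm |- _ =>
    pattern x, G;
    match goal with |- ?P _ _ =>
      revert x; refine (bim_induction P G _ _ _);
      [ defP; fail | cbv beta
      | let Hi := fresh "Hi" in let IH := fresh "IH" in
        intros ? x Hi IH; cbv beta in IH |- *; lift Hi ]
    end
  end.

(** * Arithmetic *)

Declare Scope tm_scope.
Delimit Scope tm_scope with tm.
Bind Scope tm_scope with tm.
Notation su := (C1 Succ).
Infix "+" := (C2 add_) : tm_scope.
Infix "-" := (C2 monus_) : tm_scope.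
Notation "a =[ G ] b" := (eqv G a%tm b%tm) (at level 70, no associativity).
Notation "a <=[ G ] b" := (eqv G (C2 monus_ a%tm b%tm) zero)
  (at level 70, no associativity).
Notation "a <[ G ] b" := (eqv G (C2 monus_ (C1 Succ a%tm) b%tm) zero)
  (at level 70, no associativity).
Open Scope tm_scope.

(* equations that hold by unfolding compositions and projections *)
Ltac evd := apply by_evt; reflexivity.

(* induction on [x] along an explicit formula with parameters [s], [p] *)
Ltac induct_with' x A s p :=
  match goal with G : list fm |- _ =>
    pattern x, G;
    match goal with |- ?P _ _ =>
      revert x; refine (bim_induction P G _ _ _);
      [ apply (DefP_sat A s p); intros; apply iff_refl | cbv beta
      | let Hi := fresh "Hi" in let IH := fresh "IH" in
        intros ? x Hi IH; cbv beta in IH |- *; lift Hi ]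
    end
  end.
Ltac induct_with x A := induct_with' x A Var FVar.

Lemma succ_neq_zero G x : su x =[G] zero -> prv BIM G Bot.
Proof.
  intros H. pose proof (bim_sat _ G bim_succ_neq0) as K. cbn in K.
  exact (K x G (incl_refl _) H).
Qed.

Lemma box_false G P : prv BIM G Bot -> Box G P.
Proof. intros H G' C Hi _. apply prv_botE. eapply prv_weaken; eauto. Qed.

Lemma abs G x A : su x =[G] zero -> prv BIM G A.
Proof. intros H. apply prv_botE. eapply succ_neq_zero; eauto. Qed.

Lemma pred_0 G : C1 pred_ zero =[G] zero.
Proof. apply (rec0 G 0 Zero p0 []). Qed.
Lemma pred_S G x : C1 pred_ (su x) =[G] x.
Proof. apply (recS G 0 Zero p0 x []). Qed.

Lemma succ_inj G x y : su x =[G] su y -> x =[G] y.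
Proof. intros H. rewrite <- (pred_S G x), H. apply pred_S. Qed.

Lemma nat_case G x : Box G (fun G => x =[G] zero \/ exists y, x =[G] su y).
Proof.
  (* The predecessor as explicit witness leaves a disjunction of equations, a form that [defP]
     recognises. *)
  apply (box_map G (fun G => x =[G] zero \/ x =[G] su (C1 pred_ x))).
  - induct x.
    + ret. now left.
    + ret. right. now rewrite pred_S.
  - intros G' [H|H]; eauto.
Qed.

Ltac cases x y E :=
  match goal with G : list fm |- _ =>
    open (nat_case G x) as [E|[y E]] end.

Lemma add_0 G y : zero + y =[G] y.
Proof. apply (rec0 G 1 p0 (c1 Succ p1) [y]). Qed.
Lemma add_S G x y : su x + y =[G] su (x + y).
Proof. apply (recS G 1 p0 (c1 Succ p1) x [y]). Qed.
Lemma add_0r G x : x + zero =[G] x.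
Proof.
  induct x; [apply add_0|]. now rewrite add_S, IH.
Qed.
Lemma add_Sr G x y : x + su y =[G] su (x + y).
Proof.
  induct x; [now rewrite !add_0|]. now rewrite !add_S, IH.
Qed.
Lemma add_comm G x y : x + y =[G] y + x.
Proof.
  induct x; [now rewrite add_0, add_0r|]. now rewrite add_S, add_Sr, IH.
Qed.
Lemma add_assoc G x y z : (x + y) + z =[G] x + (y + z).
Proof.
  induct x; [now rewrite !add_0|]. now rewrite !add_S, IH.
Qed.

Lemma sub_0r G x : x - zero =[G] x.
Proof.
  etransitivity; [apply ev_eqv|]. apply (rec0 G 1 p0 (c1 pred_ p1) [x]).
Qed.
Lemma sub_Sr G x y : x - su y =[G] C1 pred_ (x - y).
Proof.
  etransitivity; [apply ev_eqv|].
  etransitivity; [apply (recS G 1 p0 (c1 pred_ p1) y [x])|].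
  evd.
Qed.
Lemma sub_SS G x y : su x - su y =[G] x - y.
Proof.
  induct y; [now rewrite sub_Sr, !sub_0r, pred_S|].
  rewrite (sub_Sr G x), <- IH. apply sub_Sr.
Qed.
Lemma sub_0l G y : zero - y =[G] zero.
Proof.
  induct y; [apply sub_0r|]. now rewrite sub_Sr, IH, pred_0.
Qed.
Lemma sub_cancel G x y z : (x + y) - (x + z) =[G] y - z.
Proof.
  induct x; [now rewrite !add_0|]. now rewrite !add_S, sub_SS.
Qed.
Lemma add_sub G x y : (x + y) - x =[G] y.
Proof. rewrite <- (add_0r G x) at 2. now rewrite sub_cancel, sub_0r. Qed.
Lemma add_sub' G x y : (y + x) - x =[G] y.
Proof. rewrite add_comm. apply add_sub. Qed.
Lemma le_add G x y : x <=[G] x + y.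
Proof. rewrite <- (add_0r G x) at 1. now rewrite sub_cancel, sub_0l. Qed.
Lemma le_add' G x y : x <=[G] y + x.
Proof. rewrite add_comm. apply le_add. Qed.
Lemma le_refl G x : x <=[G] x.
Proof. rewrite <- (add_0r G x) at 2. apply le_add. Qed.
Lemma add_inj G x y z : x + y =[G] x + z -> y =[G] z.
Proof. intros H. rewrite <- (add_sub G x y), H. apply add_sub. Qed.

(** [y] is quantified in the induction formula because the step applies the hypothesis to the
    predecessor of [y]. *)
Lemma le_total G x y : Box G (fun G => x <=[G] y \/ y <[G] x).
Proof.
  revert y. induct_with x
    (AllN ((monus #1 #0 == zero) \// (monus (succ #0) #1 == zero))).
  - intros y. ret. left. apply sub_0l.
  - intros y. cases y z E.
    + ret. right. now rewrite E, sub_SS, sub_0l.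
    + open (IH z) as [H|H]; ret; [left|right]; now rewrite E, sub_SS.
Qed.

Lemma le_sub_add G x y : x <=[G] y -> y =[G] x + (y - x).
Proof.
  revert y.
  assert (H : forall y G', incl G G' -> x <=[G'] y -> y =[G'] x + (y - x)).
  - induct_with x (AllN ((monus #1 #0 == zero) ==>
      (#0 == Con add_ [#1; monus #0 #1]))).
    + intros y. world. intros _. now rewrite add_0, sub_0r.
    + intros y. world. intros H. cases y z E.
      * rewrite E, sub_0r in H. eapply abs; exact H.
      * rewrite E, sub_SS in H. rewrite E, sub_SS, add_S,
          <- (IH z G); auto using incl_refl. reflexivity.
  - intros y. apply H, incl_refl.
Qed.
Lemma le_ex G x y : x <=[G] y -> exists z, y =[G] x + z.
Proof. intros H. eexists. now apply le_sub_add. Qed.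

Lemma le_trans G x y z : x <=[G] y -> y <=[G] z -> x <=[G] z.
Proof.
  intros [u H]%le_ex [v K]%le_ex. rewrite K, H, add_assoc. apply le_add.
Qed.
Lemma le_0 G x : x <=[G] zero -> x =[G] zero.
Proof. now rewrite sub_0r. Qed.
Lemma le_S G x : x <=[G] su x.
Proof. rewrite <- (add_0 G x) at 2. rewrite <- add_S. apply le_add'. Qed.
Lemma le_SS G x y : x <=[G] y -> su x <=[G] su y.
Proof. now rewrite sub_SS. Qed.
Lemma lt_le G x y : x <[G] y -> x <=[G] y.
Proof. apply le_trans, le_S. Qed.
Lemma lt_irrefl G x : x <[G] x -> prv BIM G Bot.
Proof.
  intros [u H]%le_ex. apply succ_neq_zero with u, (add_inj G x).
  rewrite add_0r, add_Sr, <- add_S. now symmetry.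
Qed.
Lemma le_lt_false G x y : x <=[G] y -> y <[G] x -> prv BIM G Bot.
Proof.
  intros H K. apply (lt_irrefl G y). eapply le_trans; eauto.
Qed.
Lemma le_cases G x y : x <=[G] y -> Box G (fun G => x =[G] y \/ x <[G] y).
Proof.
  intros [z H]%le_ex. cases z u E; ret.
  - left. now rewrite H, E, add_0r.
  - right. rewrite H, E, add_Sr, <- add_S. apply le_add.
Qed.
Lemma lt_S_cases G x y : x <[G] su y -> Box G (fun G => x =[G] y \/ x <[G] y).
Proof. rewrite sub_SS. apply le_cases. Qed.
Lemma lt_0_false G x : x <[G] zero -> prv BIM G Bot.
Proof. rewrite sub_0r. apply succ_neq_zero. Qed.
Lemma lt_two_cases G x : x <[G] su (su zero) -> Box G (fun G => x =[G] zero \/ x =[G] su zero).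
Proof.
  intros H. open (lt_S_cases _ _ _ H) as [K|K]; [ret; auto|].
  open (lt_S_cases _ _ _ K) as [L|L]; [ret; auto|].
  apply box_false. eapply lt_0_false; eauto.
Qed.
Lemma sub_lt G x y : x <[G] y -> y - x =[G] su (y - su x).
Proof.
  intros H. apply le_sub_add in H. rewrite H at 1.
  rewrite add_S, <- add_Sr. apply add_sub.
Qed.
Lemma add_eq_0 G x y : x + y =[G] zero -> x =[G] zero /\ y =[G] zero.
Proof.
  intros H. pose proof (le_add G x y) as A. pose proof (le_add' G y x) as B.
  rewrite H, sub_0r in A, B. now split.
Qed.
Lemma le_add_mono G x y z : x <=[G] y -> x <=[G] y + z.
Proof. intros H. eapply le_trans; [exact H|apply le_add]. Qed.
Lemma le_add_mono' G x y z : x <=[G] z -> x <=[G] y + z.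
Proof. intros H. eapply le_trans; [exact H|apply le_add']. Qed.

(** * Pairing *)

Notation pJ := (C2 J_).
Notation pK := (C1 K_).
Notation pL := (C1 L_).
Notation tri := (C1 tri_).

Lemma tri_0 G : tri zero =[G] zero.
Proof. etransitivity; [apply (rec0 G 0 Zero _ [])|]. evd. Qed.
Lemma tri_S G w : tri (su w) =[G] su (w + tri w).
Proof. etransitivity; [apply (recS G 0 Zero (c1 Succ (c2 add_ p0 p1)) w [])|]. evd. Qed.

Lemma diag_0 G : C1 diag_ zero =[G] zero.
Proof. etransitivity; [apply (rec0 G 0 Zero _ [])|]. evd. Qed.
Lemma diag_S G x : C1 diag_ (su x)
  =[G] C1 diag_ x + (su zero - (tri (su (C1 diag_ x)) - su x)).
Proof. etransitivity; [apply (recS G 0 Zero _ x [])|]. evd. Qed.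

Lemma J_eq G m n : pJ m n =[G] tri (m + n) + n.
Proof. evd. Qed.

(** Inside a diagonal, for [r < w], the next triangular number minus the successor of [tri w + r] is
    still positive, so the increment in [diag_S] is zero. *)
Lemma diag_tri_add G w : C1 diag_ (tri w) =[G] w ->
  forall r, r <=[G] w -> C1 diag_ (tri w + r) =[G] w.
Proof.
  intros H r. enough (forall G', incl G G' -> r <=[G'] w -> C1 diag_ (tri w + r) =[G'] w)
    by auto using incl_refl.
  induct r.
  - world. intros _. now rewrite add_0r.
  - world. intros Hr. specialize (IH G (incl_refl _) (lt_le _ _ _ Hr)).
    rewrite add_Sr, diag_S, IH, tri_S, add_comm, sub_SS.
    rewrite (add_comm G w (tri w)), sub_cancel, (sub_lt G r w Hr), sub_SS, sub_0l.
    now rewrite add_0.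
Qed.

(** From the end [tri w + w] of a diagonal one more step reaches [tri (su w)], and there the
    increment is one. *)
Lemma diag_tri G w : C1 diag_ (tri w) =[G] w.
Proof.
  induct w; [now rewrite tri_0, diag_0|].
  rewrite tri_S, diag_S. rewrite (add_comm G w (tri w)).
  rewrite (diag_tri_add G w IH w (le_refl _ _)), tri_S.
  rewrite (add_comm G w (tri w)), le_refl, sub_0r.
  now rewrite add_Sr, add_0r.
Qed.

Lemma diag_J G m n : C1 diag_ (pJ m n) =[G] m + n.
Proof. rewrite J_eq. apply diag_tri_add; [apply diag_tri|apply le_add']. Qed.

Lemma L_J G m n : pL (pJ m n) =[G] n.
Proof.
  transitivity (pJ m n - tri (C1 diag_ (pJ m n))); [evd|].
  rewrite diag_J, J_eq. apply add_sub.
Qed.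
Lemma K_J G m n : pK (pJ m n) =[G] m.
Proof.
  transitivity (C1 diag_ (pJ m n) - pL (pJ m n)); [evd|].
  rewrite diag_J, L_J. apply add_sub'.
Qed.

Lemma J_succ_0 G n : pJ (su n) zero =[G] su (pJ zero n).
Proof. rewrite !J_eq, add_0r, add_0, add_0r, tri_S. now rewrite add_comm. Qed.
Lemma J_succ_S G m n : pJ m (su n) =[G] su (pJ (su m) n).
Proof. now rewrite !J_eq, !add_Sr, add_S. Qed.

Lemma J_surj G x : pJ (pK x) (pL x) =[G] x.
Proof.
  induct x.
  - rewrite J_eq.
    assert (H : pL zero =[G] zero).
    { transitivity (zero - tri (C1 diag_ zero)); [evd|]. apply sub_0l. }
    assert (H' : pK zero =[G] zero).
    { transitivity (C1 diag_ zero - pL zero); [evd|]. now rewrite diag_0, sub_0l. }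
    now rewrite H, H', add_0, tri_0, add_0.
  - enough (Box G (fun G => exists m n, su x =[G] pJ m n)) as B.
    { open B as [m [n H]]. now rewrite H, K_J, L_J. }
    (* The successor of a pair is one step along its diagonal, or the start of the next diagonal
       when the first component is zero. *)
    cases (pK x) m E; ret.
    + exists (su (pL x)), zero. rewrite <- IH at 1. now rewrite E, J_succ_0.
    + exists m, (su (pL x)). rewrite <- IH at 1. now rewrite E, J_succ_S.
Qed.

Lemma le_tri G w : w <=[G] tri w.
Proof.
  cases w v E; rewrite E; [apply sub_0l|]. rewrite tri_S, sub_SS. apply le_add.
Qed.
Lemma le_J1 G m n : m <=[G] pJ m n.
Proof.
  rewrite J_eq. apply le_add_mono. eapply le_trans; [|apply le_tri]. apply le_add.
Qed.
Lemma le_J2 G m n : n <=[G] pJ m n.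
Proof. rewrite J_eq. apply le_add'. Qed.

(** * Finite sequences *)

Notation sn := (C2 snoc_).
Notation pop := (C1 pop_).
Notation top := (C1 top_).
Notation pops := (C2 pops_).
Notation ln := (C1 len_).
Notation en := (C2 entry_).
Notation sg := (C1 sg_).
Notation one := (su zero).

Lemma sg_0 G : sg zero =[G] zero.
Proof. apply (rec0 G 0 Zero _ []). Qed.
Lemma sg_S G x : sg (su x) =[G] one.
Proof. etransitivity; [apply (recS G 0 Zero (c1 Succ zero_) x [])|]. evd. Qed.
Lemma sg_cases G x : Box G (fun G => sg x =[G] zero \/ sg x =[G] one).
Proof.
  cases x y E; ret; [left|right]; rewrite E; [apply sg_0|apply sg_S].
Qed.

Lemma sn_eq G s i : sn s i =[G] su (pJ s i).
Proof. evd. Qed.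
Lemma pop_0 G : pop zero =[G] zero.
Proof. apply (rec0 G 0 Zero _ []). Qed.
Lemma pop_S G x : pop (su x) =[G] pK x.
Proof. etransitivity; [apply (recS G 0 Zero (c1 K_ p0) x [])|]. evd. Qed.
Lemma top_0 G : top zero =[G] zero.
Proof. apply (rec0 G 0 Zero _ []). Qed.
Lemma top_S G x : top (su x) =[G] pL x.
Proof. etransitivity; [apply (recS G 0 Zero (c1 L_ p0) x [])|]. evd. Qed.
Lemma pop_sn G s i : pop (sn s i) =[G] s.
Proof. rewrite sn_eq, pop_S. apply K_J. Qed.
Lemma top_sn G s i : top (sn s i) =[G] i.
Proof. rewrite sn_eq, top_S. apply L_J. Qed.

Lemma seq_case G t :
  Box G (fun G => t =[G] zero \/ t =[G] sn (pop t) (top t)).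
Proof.
  cases t x E; ret; [now left|]. right.
  now rewrite sn_eq, E, pop_S, top_S, J_surj.
Qed.
(** Popping strictly decreases a nonempty code, so popping [s] times empties [s] and lengths are
    bounded by codes. *)
Lemma pop_le G t : pop t <=[G] C1 pred_ t.
Proof.
  cases t x E; rewrite E.
  - rewrite pop_0. apply sub_0l.
  - rewrite pop_S, pred_S. rewrite <- (J_surj G x) at 2. apply le_J1.
Qed.

Lemma pops_0 G s : pops zero s =[G] s.
Proof. apply (rec0 G 1 p0 (c1 pop_ p1) [s]). Qed.
Lemma pops_S G n s : pops (su n) s =[G] pop (pops n s).
Proof. etransitivity; [apply (recS G 1 p0 (c1 pop_ p1) n [s])|]. evd. Qed.
Lemma pops_S' G n s : pops (su n) s =[G] pops n (pop s).
Proof.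
  induct n; [now rewrite pops_S, !pops_0|].
  now rewrite pops_S, IH, pops_S.
Qed.
Lemma pops_sn G n s i : pops (su n) (sn s i) =[G] pops n s.
Proof. now rewrite pops_S', pop_sn. Qed.
Lemma pops_add G i j t : pops j (pops i t) =[G] pops (j + i) t.
Proof.
  induct j; [now rewrite add_0, pops_0|]. now rewrite add_S, !pops_S, IH.
Qed.
Lemma pops_nil G n : pops n zero =[G] zero.
Proof.
  induct n; [now rewrite pops_0|]. now rewrite pops_S, IH, pop_0.
Qed.
Lemma pred_le_mono G x y : x <=[G] y -> C1 pred_ x <=[G] C1 pred_ y.
Proof.
  intros H. cases x u E; rewrite E in H |- *; [rewrite pred_0; apply sub_0l|].
  cases y v E'; rewrite E' in H |- *.
  - apply le_0 in H. eapply abs; exact H.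
  - rewrite sub_SS in H. now rewrite !pred_S.
Qed.
Lemma pops_le G n s : pops n s <=[G] s - n.
Proof.
  induct n.
  - rewrite pops_0, sub_0r. apply le_refl.
  - rewrite pops_S, sub_Sr. eapply le_trans; [apply pop_le|]. now apply pred_le_mono.
Qed.
Lemma pops_ge G n s : s <=[G] n -> pops n s =[G] zero.
Proof.
  intros H. apply le_0. pose proof (pops_le G n s) as A. now rewrite H in A.
Qed.

Lemma count_0 G s : C2 count_ zero s =[G] zero.
Proof. etransitivity; [apply (rec0 G 1 zero_ _ [s])|]. evd. Qed.
Lemma count_S G n s : C2 count_ (su n) s =[G] C2 count_ n s + sg (pops n s).
Proof.
  etransitivity; [apply (recS G 1 zero_ (c2 add_ p1 (c1 sg_ (c2 pops_ p0 p2))) n [s])|].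
  evd.
Qed.
Lemma count_S' G n s : C2 count_ (su n) s =[G] sg s + C2 count_ n (pop s).
Proof.
  induct n.
  - now rewrite count_S, !count_0, pops_0, add_comm.
  - now rewrite count_S, IH, (count_S G n (pop s)), pops_S', add_assoc.
Qed.
Lemma count_le G n s : C2 count_ n s <=[G] n.
Proof.
  induct n.
  - rewrite count_0. apply sub_0l.
  - rewrite count_S. open (sg_cases G (pops n s)) as [E|E]; rewrite E.
    + rewrite add_0r. eapply le_trans; [exact IH|apply le_S].
    + now rewrite add_Sr, add_0r, sub_SS.
Qed.
(** Further counting adds nothing once [s] is empty. This matters for [ln_sn], where the longer
    sequence is counted up to its own, larger code. *)
Lemma count_ge G s z : C2 count_ (s + z) s =[G] ln s.
Proof.
  induct z.
  - rewrite add_0r. evd.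
  - rewrite add_Sr, count_S, IH, pops_ge by apply le_add.
    now rewrite sg_0, add_0r.
Qed.

Lemma ln_0 G : ln zero =[G] zero.
Proof. transitivity (C2 count_ zero zero); [evd|]. apply count_0. Qed.
Lemma ln_sn G s i : ln (sn s i) =[G] su (ln s).
Proof.
  transitivity (C2 count_ (sn s i) (sn s i)); [evd|].
  rewrite sn_eq at 1. rewrite count_S', pop_sn.
  assert (H : s <=[G] pJ s i) by apply le_J1. apply le_sub_add in H.
  rewrite H, count_ge, sn_eq, sg_S. now rewrite add_S, add_0.
Qed.
Lemma ln_le G s : ln s <=[G] s.
Proof. transitivity (C2 count_ s s - s); [evd|]. apply count_le. Qed.
Lemma ln_eq_0 G s : ln s =[G] zero -> s =[G] zero.
Proof.
  intros H. open (seq_case G s) as [E|E]; [exact E|].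
  rewrite E, ln_sn in H. eapply abs; exact H.
Qed.
Lemma ln_pos G s n : ln s =[G] su n -> s =[G] sn (pop s) (top s) /\ ln (pop s) =[G] n.
Proof.
  intros H. assert (E : s =[G] sn (pop s) (top s)).
  { open (seq_case G s) as [E|E]; [|exact E].
    rewrite E, ln_0 in H. symmetry in H. eapply abs; exact H. }
  split; auto. rewrite E, ln_sn in H. now apply succ_inj in H.
Qed.
Lemma ln_pop G s : ln (pop s) =[G] C1 pred_ (ln s).
Proof.
  open (seq_case G s) as [E|E]; rewrite E.
  - now rewrite pop_0, ln_0, pred_0.
  - now rewrite pop_sn, ln_sn, pred_S.
Qed.
Lemma ln_pops G n s : ln (pops n s) =[G] ln s - n.
Proof.
  induct n; [now rewrite pops_0, sub_0r|]. now rewrite pops_S, ln_pop, IH, sub_Sr.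
Qed.
Lemma pops_ln G s : pops (ln s) s =[G] zero.
Proof. apply ln_eq_0. rewrite ln_pops. apply le_refl. Qed.

Lemma en_eq G s i : en s i =[G] top (pops (ln s - su i) s).
Proof. evd. Qed.
Lemma en_last G s x : en (sn s x) (ln s) =[G] x.
Proof. rewrite en_eq, ln_sn, le_refl, pops_0. apply top_sn. Qed.
Lemma en_sn G s x i : i <[G] ln s -> en (sn s x) i =[G] en s i.
Proof.
  intros H. now rewrite !en_eq, ln_sn, sub_SS, (sub_lt _ _ _ H), pops_sn.
Qed.

(** * Functions *)

Lemma fun_comp G F H :
  Box G (fun G => exists M, forall x, ap M x =[G] ap F (ap H x)).
Proof. exact (bim_sat _ G bim_fun_comp F H). Qed.

Lemma fun_rec G F H : Box G (fun G => exists M, forall m n,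
  ap M (pJ m zero) =[G] ap F m /\
  ap M (pJ m (su n)) =[G] ap H (pJ (pJ m n) (ap M (pJ m n)))).
Proof. exact (bim_sat _ G bim_fun_rec F H). Qed.

(** [c] may contain variables, so no function symbol need denote this constant. It is built by
    induction on [c] inside the theory, composing with the successor. *)
Lemma fun_const G c : Box G (fun G => exists F, forall x, ap F x =[G] c).
Proof.
  induct_with c (ExF (AllN (App 0 #0 == #1))).
  - ret. exists (FCon zero_). intros x. evd.
  - open IH as [F HF]. open (fun_comp G (FCon Succ) F) as [M HM].
    ret. exists M. intros x. rewrite HM, HF. reflexivity.
Qed.

(* [bim_fun_rec] is the only axiom that combines two functions: one recursion step suffices. *)
Lemma fun_graph1 G F (h : prf 2) :
  Box G (fun G => exists M, forall x, ap M x =[G] C2 h x (ap F x)).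
Proof.
  (* At the step from 0 to 1 the recursion passes the coded triple of [x], 0 and [F x]; [b] reads
     its first and last components. *)
  pose (b := c2 h (c1 K_ (c1 K_ p0)) (c1 L_ p0) : prf 1).
  open (fun_rec G F (FCon b)) as [M HM].
  open (fun_comp G M (FCon (c2 J_ p0 (c1 Succ zero_)))) as [N HN].
  ret. exists N. intros x. rewrite HN.
  transitivity (ap M (pJ x one)).
  { apply ap_proper. evd. }
  rewrite (proj2 (HM x zero)), (proj1 (HM x zero)).
  transitivity (C2 h (pK (pK (pJ (pJ x zero) (ap F x)))) (pL (pJ (pJ x zero) (ap F x)))).
  { evd. }
  now rewrite !K_J, L_J.
Qed.

(** The recursion step [B] applies [H] to the first component of the coded triple; [fun_graph1]
    combines this value with the triple itself. *)
Lemma fun_graph2 G F H (h : prf 2) :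
  Box G (fun G => exists M, forall x, ap M x =[G] C2 h (ap F x) (ap H x)).
Proof.
  open (fun_comp G H (FCon (c1 K_ K_))) as [H' HH'].
  open (fun_graph1 G H' (c2 h (c1 L_ p0) p1)) as [B HB].
  open (fun_rec G F B) as [M HM].
  open (fun_comp G M (FCon (c2 J_ p0 (c1 Succ zero_)))) as [N HN].
  ret. exists N. intros x. rewrite HN.
  transitivity (ap M (pJ x one)).
  { apply ap_proper. evd. }
  rewrite (proj2 (HM x zero)), (proj1 (HM x zero)), HB, HH'.
  transitivity (C2 h (pL (pJ (pJ x zero) (ap F x)))
                     (ap H (pK (pK (pJ (pJ x zero) (ap F x)))))).
  { transitivity (C2 h (pL (pJ (pJ x zero) (ap F x)))
      (ap H (ap (FCon (c1 K_ K_)) (pJ (pJ x zero) (ap F x))))); [evd|].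
    apply C2_proper; [reflexivity|]. apply ap_proper. evd. }
  now rewrite !K_J, L_J.
Qed.

(* The arguments of a symbol are packed into one function with projections [ps]. *)
Lemma fun_tm G t :
  Box G (fun G => exists F, forall x, ap F x =[G] sub_tm (scons x Var) FVar t).
Proof.
  revert G. induction t as [[|i]|n f ts IH|i t IH] using tm_nested_ind; intros G.
  - ret. exists (FCon p0). intros x. evd.
  - exact (fun_const G (Var i)).
  - assert (V : Box G (fun G => exists F (ps : Vector.t (prf 1) n),
      Vector.Forall2 (fun p t => forall x,
        Con p [ap F x] =[G] sub_tm (scons x Var) FVar t) ps ts)).
    { clear f. induction IH as [|n t ts IHt _ IH].
      - ret. exists (FCon zero_), []. apply Vector.Forall2_nil.
      - open (IHt G) as [F HF]. open IH as [F' [ps HP]].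
        open (fun_graph2 G F F' J_) as [M HM].
        ret. exists M, (K_ :: Vector.map (fun p => c1 p L_) ps).
        apply Vector.Forall2_cons.
        + intros x. rewrite <- HF, <- (K_J G (ap F x) (ap F' x)), <- HM. reflexivity.
        + clear - HP HM. induction HP as [|n p t ps ts Hp _ IH]; cbn; constructor; auto.
          intros x. rewrite <- Hp.
          change (C1 (c1 p L_) (ap M x) =[G] C1 p (ap F' x)). rewrite HM.
          transitivity (C1 p (pL (pJ (ap F x) (ap F' x)))); [evd|]. now rewrite L_J. }
    open V as [F [ps HP]]. open (fun_comp G (FCon (Comp f ps)) F) as [M HM].
    ret. exists M. intros x. rewrite HM. cbn. etransitivity; [apply prv_ax, bim_comp|].
    apply con_cong. clear - HP. induction HP; cbn; constructor; auto.
  - open (IH G) as [F HF]. open (fun_comp G (FVar i) F) as [M HM].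
    ret. exists M. intros x. rewrite HM, HF. reflexivity.
Qed.

(** * Functions from definable operations: iteration and bounded sums *)

Lemma DefT_proper G f : DefT f -> Morphisms.Proper (Morphisms.respectful (eqv G) (eqv G)) f.
Proof.
  intros [t H] a b E.
  pose proof (eqv_leib G (shN (f a) == t) Var FVar a b E) as K.
  cbn in K. rewrite !sub_shN, !sub_tm_id, !H in K. apply K. reflexivity.
Qed.

Lemma DefT_comp f g : DefT f -> DefT g -> DefT (fun x => f (g x)).
Proof.
  intros [t H] [u K]. exists (sub_tm (scons u (fun i => Var (S i))) FVar t).
  intros x. rewrite sub_tm_comp, <- H. apply sub_tm_ext; auto.
  intros [|i]; cbn; auto.
Qed.

Lemma fun_def G f : DefT f -> Box G (fun G => exists F, forall x, ap F x =[G] f x).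
Proof.
  intros [t H]. refine (box_map _ _ _ (fun_tm G t) _). intros G' [F HF].
  exists F. intros x. rewrite HF, H. reflexivity.
Qed.

(** Row zero of the recursion axiom, with the dummy parameter dropped from the coded triple. Joint
    definability of [b] provides the step function; definability in each argument provides
    congruence. *)
Lemma fun_iter G c (b : tm -> tm -> tm) :
  DefT (fun y => b (pK y) (pL y)) -> (forall x, DefT (b x)) -> (forall y, DefT (fun x => b x y)) ->
  Box G (fun G => exists F, ap F zero =[G] c /\ forall n, ap F (su n) =[G] b n (ap F n)).
Proof.
  intros Hb Hb1 Hb2. open (fun_const G c) as [F HF].
  assert (Hb' : DefT (fun y => (fun z => b (pK z) (pL z)) (pJ (pL (pK y)) (pL y)))).
  { apply (DefT_comp _ (fun y => pJ (pL (pK y)) (pL y)) Hb). defT. }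
  open (fun_def G _ Hb') as [B HB].
  open (fun_rec G F B) as [M HM].
  open (fun_def G (fun n => ap M (pJ zero n)) ltac:(defT)) as [N HN].
  ret. exists N. split.
  - now rewrite HN, (proj1 (HM zero zero)), HF.
  - intros n. rewrite (DefT_proper G _ (Hb1 n) _ _ (HN n)).
    rewrite HN, (proj2 (HM zero n)), HB.
    set (y := pJ (pJ zero n) (ap M (pJ zero n))).
    rewrite (DefT_proper G _ Hb (pJ (pL (pK y)) (pL y)) (pJ n (ap M (pJ zero n)))).
    + rewrite (DefT_proper G _ (Hb1 _) (pL _) _ (L_J G _ _)).
      apply (DefT_proper G _ (Hb2 _) _ _ (K_J G _ _)).
    + unfold y. now rewrite !K_J, !L_J.
Qed.

(** A sum vanishes exactly when all its terms do, so sums express a bounded universal quantifier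
    over equations [f m n = 0] by one equation. *)
Lemma fun_sum G (f : tm -> tm -> tm) :
  DefT (fun y => f (pK y) (pL y)) -> (forall x, DefT (f x)) -> (forall y, DefT (fun x => f x y)) ->
  Box G (fun G => exists F, forall m, ap F (pJ m zero) =[G] zero /\
    forall n, ap F (pJ m (su n)) =[G] ap F (pJ m n) + f m n).
Proof.
  intros Hf Hf1 Hf2.
  open (fun_def G _ Hf) as [F HF].
  open (fun_def G (fun y => pL y + ap F (pK y)) ltac:(defT)) as [B HB].
  open (fun_rec G (FCon zero_) B) as [M HM].
  ret. exists M. intros m. split.
  - rewrite (proj1 (HM m zero)). evd.
  - intros n. rewrite (proj2 (HM m n)), HB, L_J, K_J, HF. apply C2_proper; [reflexivity|].
    rewrite (DefT_proper G _ (Hf1 _) _ _ (L_J G _ _)).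
    apply (DefT_proper G _ (Hf2 _) _ _ (K_J G _ _)).
Qed.

Lemma sum_zero F f m (Hf : DefT f) G n t :
  (forall n, ap F (pJ m (su n)) =[G] ap F (pJ m n) + f n) ->
  ap F (pJ m n) =[G] zero -> t <[G] n -> f t =[G] zero.
Proof.
  intros HS.
  enough (forall G', incl G G' -> ap F (pJ m n) =[G'] zero ->
    forall G'', incl G' G'' -> t <[G''] n -> f t =[G''] zero) as H.
  { intros H1 H2. eapply H; eauto using incl_refl. }
  induct n.
  - world. intros _. world. intros H. apply prv_botE. eapply lt_0_false; exact H.
  - world. intros H. world. intros H'. rewrite HS in H. apply add_eq_0 in H as [H1 H2].
    open (lt_S_cases _ _ _ H') as [E|E].
    + now rewrite (DefT_proper G _ Hf _ _ E).
    + exact (IH G (incl_refl _) H1 G (incl_refl _) E).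
Qed.

Lemma sum_zero_intro F (f : tm -> tm) m G n : ap F (pJ m zero) =[G] zero ->
  (forall n, ap F (pJ m (su n)) =[G] ap F (pJ m n) + f n) ->
  (forall t G', incl G G' -> t <[G'] n -> f t =[G'] zero) ->
  ap F (pJ m n) =[G] zero.
Proof.
  intros H0 HS H.
  (* The hypothesis concerns terms below the fixed [n], so the induction runs over partial sums up
     to [k <= n]. *)
  assert (forall k G', incl G G' -> k <=[G'] n -> ap F (pJ m k) =[G'] zero) as K.
  { intros k. induct k.
    - world. intros _. exact H0.
    - world. intros Hk. rewrite HS, (H k G (incl_refl _) Hk), add_0r.
      apply IH; [apply incl_refl|]. now apply lt_le. }
  apply K, le_refl. apply incl_refl.
Qed.

(** * Initial segments *)

Notation two' := (su (su zero)).
Notation path G F g :=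
  (ap g zero =[G] zero /\ forall n, ap g (su n) =[G] sn (ap g n) (ap F n)).
Notation init G F n c := (ln c =[G] n /\
  forall i G', incl G G' -> i <[G'] n -> en c i =[G'] ap F i).
Notation bin G s := (forall i G', incl G G' -> i <[G'] ln s -> en s i <[G'] two').
Notation cantor G F := (forall n, ap F n <[G] two').
Notation nz G x := (forall G', incl G G' -> x%tm =[G'] zero -> prv BIM G' Bot).

Lemma path_ex G F : Box G (fun G => exists g, path G F g).
Proof.
  apply (fun_iter G zero (fun n v => sn v (ap F n))); intros; defT.
Qed.

Lemma path_ln F g G n : path G F g -> ln (ap g n) =[G] n.
Proof.
  intros [H0 HS]. induct n; [now rewrite H0, ln_0|]. now rewrite HS, ln_sn, IH.
Qed.

Lemma path_en F g G n i : path G F g -> i <[G] n -> en (ap g n) i =[G] ap F i.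
Proof.
  intros P.
  enough (forall G', incl G G' -> i <[G'] n -> en (ap g n) i =[G'] ap F i) by
    auto using incl_refl.
  induct n.
  - world. intros H. apply prv_botE. eapply lt_0_false; exact H.
  - world. intros H. rewrite (proj2 P). open (lt_S_cases _ _ _ H) as [E|E].
    + rewrite E. transitivity (en (sn (ap g n) (ap F n)) (ln (ap g n))).
      * now rewrite (path_ln F g G n P).
      * apply en_last.
    + rewrite en_sn; [now apply IH, E|]. now rewrite (path_ln F g G n P).
Qed.

Lemma path_init F g G n : path G F g -> init G F n (ap g n).
Proof.
  intros P. split; [now apply (path_ln F g)|]. intros i. world. now apply path_en.
Qed.

(** Each number codes exactly one sequence, so length and entries determine the code; the induction
    removes the last entry. *)
Lemma path_uniq F g G n c : path G F g -> init G F n c -> c =[G] ap g n.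
Proof.
  intros P. revert c.
  enough (forall c G', incl G G' -> init G' F n c -> c =[G'] ap g n) as H
    by (intros c; apply H, incl_refl).
  pattern n, G. match goal with |- ?Q _ _ => refine (bim_induction Q G _ _ _ n) end.
  - apply (DefP_sat (AllN ((len #0 == #1) //\
      AllN (lt #0 #2 ==> entry #1 #0 == App 0 #0) ==> #0 == App 1 #1))
      Var (scons F (scons g FVar))). intros; apply iff_refl.
  - intros c. world. intros [H _]. rewrite (proj1 P). now apply ln_eq_0.
  - intros G' k Hi IH. lift Hi. intros c. world. intros [H Hc].
    destruct (ln_pos _ _ _ H) as [E El]. rewrite (proj2 P), E. apply C2_proper.
    + apply IH; [apply incl_refl|]. split; auto. intros i. world. intros Hik.
      rewrite <- Hc; auto using incl_refl; [|now apply lt_le, le_SS].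
      rewrite E at 2. rewrite en_sn; [reflexivity|]. now rewrite El.
    + rewrite <- Hc; [|apply incl_refl|apply le_refl].
      rewrite E at 2. rewrite <- El. symmetry. apply en_last.
Qed.

Lemma path_bin F g G n : path G F g -> cantor G F -> bin G (ap g n).
Proof.
  intros P HC i. world. rewrite (path_ln _ _ _ _ P). intros Hi.
  now rewrite (path_en _ _ _ _ _ P Hi).
Qed.

Lemma path_le F g G n : path G F g -> n <=[G] ap g n.
Proof. intros P. rewrite <- (path_ln F g G n P) at 1. apply ln_le. Qed.

Lemma path_pops F g G j n : path G F g -> pops j (ap g n) =[G] ap g (n - j).
Proof.
  intros P. induct j; [now rewrite pops_0, sub_0r|].
  rewrite pops_S, IH, sub_Sr. cases (n - j) k E; rewrite E.
  - now rewrite pred_0, (proj1 P), pop_0.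
  - now rewrite pred_S, (proj2 P), pop_sn.
Qed.

Lemma pos_nz G x y : x =[G] su y -> nz G x.
Proof. intros H. world. rewrite H. apply succ_neq_zero. Qed.

(** * Bars *)

(** [Bar] and [Hered] follow the clauses of [sat] for [bar] and [hereditary], including one [Box]
    per existential quantifier, so that the final theorem passes between them by conversion. *)
Definition Bar G (B : ctx -> tm -> Prop) : Prop :=
  forall F G', incl G G' -> cantor G' F -> Box G' (fun G => exists n, Box G (fun G =>
    exists c, init G F n c /\ B G c)).
Definition Hered G (B : ctx -> tm -> Prop) : Prop :=
  forall s G', incl G G' -> bin G' s ->
    (forall G1, incl G' G1 -> B G1 s ->
      forall i G2, incl G1 G2 -> i <[G2] two' -> B G2 (sn s i)) /\
    (forall G1, incl G' G1 ->
      (forall i G2, incl G1 G2 -> i <[G2] two' -> B G2 (sn s i)) -> B G1 s).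
Notation Dset F := (fun G x => nz G (ap F x)).
Notation Eset F := (fun G x => Box G (fun G => exists p, ap F p =[G] su x)).

Lemma Bar_mono B : Mono (fun G => Bar G B).
Proof. unfold Bar. mono. Qed.
Lemma Hered_mono B : Mono (fun G => Hered G B).
Proof. unfold Hered. mono. Qed.

Ltac mono_step ::=
  first [ apply Bar_mono | apply Hered_mono
        | apply mono_prv | apply mono_eqv | apply mono_sat | apply mono_incl
        | apply mono_box | apply mono_later
        | apply mono_and | apply mono_or
        | apply mono_ex; intros ? | apply mono_all; intros ?
        | apply mono_Forall2; intros ? ?
        | match goal with M : forall _, Mono _ |- _ => apply M end
        | apply mono_const ].

Lemma nz_proper G x y : x =[G] y -> nz G x -> nz G y.
Proof. intros E H. world. intros K. apply H; [apply incl_refl|]. now rewrite E. Qed.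
Lemma Dset_proper F G x y : x =[G] y -> Dset F G x -> Dset F G y.
Proof. intros E. cbv beta. apply nz_proper. now rewrite E. Qed.
Lemma Eset_proper F G x y : x =[G] y -> Eset F G x -> Eset F G y.
Proof. intros E H. open H as [p Hp]. ret. exists p. now rewrite <- E. Qed.

Lemma Bar_path G B F g : Bar G B -> cantor G F -> path G F g ->
  (forall x, Mono (fun G => B G x)) -> (forall (G : ctx) x y, x =[G] y -> B G x -> B G y) ->
  Box G (fun G => exists n, B G (ap g n)).
Proof.
  intros HB HC P M HP. open (HB F G (incl_refl _) HC) as [n H].
  refine (box_bind _ _ _ H _). intros G' Hi [c [I Hc]]. clear H. lift Hi.
  apply (box_ret (fun G => exists n, B G (ap g n))); [|apply mono_ex; auto].
  exists n. eapply HP; [|exact Hc]. eapply path_uniq; eauto.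
Qed.

Lemma Bar_intro G B :
  (forall x, Mono (fun G => B G x)) ->
  (forall F g G', incl G G' -> cantor G' F -> path G' F g ->
    Box G' (fun G => exists n, B G (ap g n))) -> Bar G B.
Proof.
  intros M H F. world. intros HC. open (path_ex G F) as [g P].
  refine (box_bind _ _ _ (H F g G (incl_refl _) HC P) _).
  intros G' Hi [n Hn]. apply box_ret; [exists n|mono].
  apply box_ret; [exists (ap g n)|apply mono_ex; intros; apply mono_and; [mono|apply M]].
  split; [|exact Hn]. apply path_init. lift Hi. exact P.
Qed.

Lemma sg_lt_two G x : sg x <[G] two'.
Proof.
  rewrite sub_SS. open (sg_cases G x) as [E|E]; rewrite E; [apply sub_0l|apply le_refl].
Qed.
Lemma zero_lt_two G : zero <[G] two'.
Proof. rewrite sub_SS. apply sub_0l. Qed.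
Lemma one_lt_two G : one <[G] two'.
Proof. apply le_refl. Qed.

(** * Decidable bar induction *)

Lemma dec_bar_induction G F : Bar G (Dset F) -> Hered G (Dset F) -> Dset F G zero.
Proof.
  intros HB HH. world. intros E0.
  (* The next digit is [sg] of [F] at the child 0: it is 0 when that child is outside the bar and 1
     otherwise. *)
  open (fun_iter G zero (fun _ v => sn v (sg (ap F (sn v zero))))
    ltac:(defT) ltac:(intros; defT) ltac:(intros; defT)) as [g [g0 gS]].
  open (fun_def G (fun n => sg (ap F (sn (ap g n) zero))) ltac:(defT)) as [C HC].
  assert (P : path G C g).
  { split; auto. intros n. now rewrite gS, HC. }
  assert (CC : cantor G C) by (intros n; rewrite HC; apply sg_lt_two).
  assert (Z : forall n, ap F (ap g n) =[G] zero).
  { intros n. induct n; [now rewrite g0|].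
    rewrite gS. cases (ap F (sn (ap g n) zero)) y E.
    - rewrite E, sg_0. exact E.
    - rewrite E, sg_S. cases (ap F (sn (ap g n) one)) z E1; [exact E1|].
      (* Both children lie in the bar, so heredity puts [ap g n] in it as well, against the
         induction hypothesis. *)
      apply prv_botE.
      destruct (HH (ap g n) G (incl_refl _) (path_bin _ _ _ _ P CC)) as [_ H].
      refine (H G (incl_refl _) _ G (incl_refl _) IH).
      intros i. world. intros Hi.
      world. intros A. open (lt_two_cases _ _ Hi) as [B|B];
        rewrite B in A; rewrite ?E, ?E1 in A; eapply succ_neq_zero; exact A. }
  open (Bar_path G _ C g HB CC P ltac:(intros; mono) (Dset_proper F)) as [n H].
  exact (H G (incl_refl _) (Z n)).
Qed.

(** * Equality test and binary sequences *)

Lemma le_antisym G x y : x <=[G] y -> y <=[G] x -> x =[G] y.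
Proof. intros H H'. apply le_sub_add in H. now rewrite H, H', add_0r. Qed.
Lemma sub_sub G x y : x <=[G] y -> y - (y - x) =[G] x.
Proof.
  intros [z H]%le_ex. rewrite H, add_sub. apply add_sub'.
Qed.
Lemma sub_le G x y : x - y <=[G] x.
Proof.
  induct y; [rewrite sub_0r; apply le_refl|].
  rewrite sub_Sr. eapply le_trans; [|exact IH].
  cases (x - y) z E; rewrite E; [rewrite pred_0; apply sub_0l|].
  rewrite pred_S. apply le_S.
Qed.

Notation eqt x y := (C2 monus_ one (C2 add_ (C2 monus_ x y) (C2 monus_ y x))).

Lemma eqt_refl G x y : x =[G] y -> eqt x y =[G] one.
Proof. intros H. now rewrite H, le_refl, add_0, sub_0r. Qed.
Lemma eqt_nz G x y : nz G (eqt x y) -> x =[G] y.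
Proof.
  intros H. cases ((x - y) + (y - x)) z E.
  - apply add_eq_0 in E as []. now apply le_antisym.
  - apply prv_botE, H; [apply incl_refl|]. now rewrite E, sub_SS, sub_0l.
Qed.

Lemma bin_sn G s i : bin G s -> i <[G] two' -> bin G (sn s i).
Proof.
  intros Hs Hi j. world. rewrite ln_sn. intros Hj.
  open (lt_S_cases _ _ _ Hj) as [E|E].
  - now rewrite E, en_last.
  - rewrite en_sn; auto using incl_refl.
Qed.
(* beyond the length, [entry] repeats the last entry *)
Lemma bin_en G s i : bin G s -> en s i <[G] two'.
Proof.
  intros Hs. open (le_total G (su i) (ln s)) as [H|H]; [auto using incl_refl|].
  rewrite sub_SS in H. rewrite en_eq. rewrite (le_trans _ _ _ _ H (le_S _ _)), pops_0.
  cases (ln s) k E.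
  - apply ln_eq_0 in E. rewrite E, top_0. apply zero_lt_two.
  - assert (A : en s k <[G] two') by (apply Hs; [apply incl_refl|rewrite E; apply le_refl]).
    now rewrite en_eq, E, le_refl, pops_0 in A.
Qed.
Lemma bin_nil G : bin G zero.
Proof. intros i. world. rewrite ln_0. intros H. apply prv_botE. eapply lt_0_false; exact H. Qed.

(** * The Fan Theorem implies bar induction for enumerable bars *)

Notation Dcset b := (fun G x => x <[G] ln b /\ nz G (en b x)).
Definition Fan G := forall F G', incl G G' -> Bar G' (Dset F) ->
  Box G' (fun G => exists n, Box G (fun G => exists b, init G F n b /\ Bar G (Dcset b))).

Lemma Dcset_proper b G x y : x =[G] y -> Dcset b G x -> Dcset b G y.
Proof.
  intros E [H H']. split; [now rewrite <- E|]. revert H'. apply nz_proper. now rewrite E.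
Qed.

Lemma fan_bar_induction G F :
  Fan G -> Bar G (Eset F) -> Hered G (Eset F) -> Eset F G zero.
Proof.
  intros HF HB HH.
  (* The stage is [K (ln t)], so that every stage occurs at arbitrarily large lengths. *)
  open (fun_def G (fun t => eqt (su (pops (ln t - ln (C1 pred_ (ap F (pK (ln t))))) t))
    (ap F (pK (ln t)))) ltac:(defT)) as [b Hb].
  assert (BD : Bar G (Dset b)).
  { apply Bar_intro; [intros; mono|]. intros C g. world. intros HC P.
    open (Bar_path G _ C g HB HC P ltac:(intros; mono) (Eset_proper F)) as [m H].
    (* At length [pJ p m] the coded stage is [p], and [m <= pJ p m] makes the segment of length [m]
       available by popping. *)
    open H as [p Hp]. ret. exists (pJ p m). apply pos_nz with zero.
    rewrite Hb. apply eqt_refl.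
    rewrite (path_ln _ _ _ _ P), K_J, Hp, pred_S, (path_ln _ _ _ _ P), (path_pops _ _ _ _ _ P).
    rewrite sub_sub; [reflexivity|apply le_J2]. }
  open (HF b G (incl_refl _) BD) as [n H]. open H as [c [[Hln Hen] HC]]. clear BD.
  (* All binary sequences of length [n] are in the bar. Such an [s] is extended to a path by [en s],
     which stays binary beyond the length. *)
  assert (Hn : forall s G', incl G G' -> bin G' s -> ln s =[G'] n -> Eset F G' s).
  { intros s. world. intros Hs Hsn.
    open (fun_def G (en s) ltac:(defT)) as [C EC].
    assert (CC : cantor G C) by (intros i; rewrite EC; now apply bin_en).
    open (path_ex G C) as [g P].
    open (Bar_path G _ C g HC CC P ltac:(intros; mono) (Dcset_proper c)) as [m [Hm1 Hm2]].
    rewrite Hln in Hm1.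
    pose proof (eqt_nz _ _ _ (nz_proper _ _ _ (Hb (ap g m))
      (nz_proper _ _ _ (Hen (ap g m) G (incl_refl _) Hm1) Hm2))) as E.
    clear Hm2; rename E into Hm2.
    rewrite (path_pops _ _ _ _ _ P) in Hm2.
    (* The enumerated segment has length [k <= m], and [m] is at most the code [ap g m], which is
       below [n]. *)
    assert (H : exists p k, ap F p =[G] su (ap g k) /\ k <=[G] n).
    { eexists _, _. split; [symmetry; exact Hm2|].
      eapply le_trans; [apply sub_le|]. eapply le_trans; [apply (path_le _ _ _ m P)|].
      now apply lt_le. }
    clear Hm2. destruct H as [p [k [Hp Hk]]].
    (* Heredity carries membership from length [k] forward along the path to length [n]. *)
    assert (HE : forall j, Eset F G (ap g (k + j))).
    { intros j. induct_with' j (ExN (App 1 #0 == succ (App 0 (Con add_ [#2; #1]))))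
        (scons k Var) (scons g (scons F FVar)).
      - ret. exists p. now rewrite add_0r.
      - destruct (HH (ap g (k + j)) G (incl_refl _) (path_bin _ _ _ _ P CC)) as [H _].
        apply (Eset_proper F G (sn (ap g (k + j)) (ap C (k + j)))).
        + now rewrite add_Sr, (proj2 P).
        + apply (H G (incl_refl _) IH); auto using incl_refl. }
    apply (Eset_proper F G (ap g (k + (n - k)))); [|apply HE].
    rewrite <- (le_sub_add _ _ _ Hk). symmetry. apply (path_uniq C g G n s P).
    split; [exact Hsn|]. intros i. world. intros _. now rewrite EC. }
  (* Backward induction: [k] is the distance of the length of [s] from [n]. *)
  assert (A : forall k s G', incl G G' -> bin G' s /\ ln s + k =[G'] n -> Eset F G' s).
  { intros k. induct_with' k (AllN (inBin #0 //\ (Con add_ [len #0; #1] == #2) ==>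
        ExN (App 0 #0 == succ #1))) (scons n Var) (scons F FVar).
    - intros s. world. intros [Hs Hk]. rewrite add_0r in Hk. auto using incl_refl.
    - intros s. world. intros [Hs Hk].
      destruct (HH s G (incl_refl _) Hs) as [_ H].
      apply (H G (incl_refl _)). intros i. world. intros Hi.
      apply IH; [apply incl_refl|]. split; [now apply bin_sn|].
      now rewrite ln_sn, add_S, <- add_Sr. }
  apply (A n zero G (incl_refl _)). split; [apply bin_nil|]. now rewrite ln_0, add_0.
Qed.

(** * Bar induction for enumerable bars implies the Fan Theorem *)

(** A guard for summands: [cond_(x,y) = 0] demands [y = 0] only where [x = 0]. *)
Definition cond_ : prf 2 := Rec p0 zero_.
Lemma cond_0 G y : C2 cond_ zero y =[G] y.
Proof. apply (rec0 G 1 p0 zero_ [y]). Qed.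
Lemma cond_S G x y : C2 cond_ (su x) y =[G] zero.
Proof. etransitivity; [apply (recS G 1 p0 zero_ x [y])|]. evd. Qed.

(* [delta F t] is zero iff [t] is not in [D_F] and its last entry is below two, so that unbarred
   sequences are automatically binary. *)
Notation delta F t := (C2 add_ (ap F t) (C2 monus_ (top t) one)).
Notation unbarred G F B := (forall t G', incl G G' ->
  (ap B t =[G'] zero -> forall i, delta F (pops i t) =[G'] zero) /\
  ((forall i G'', incl G' G'' -> delta F (pops i t) =[G''] zero) -> ap B t =[G'] zero)).
Notation ext G t s := (pops (ln t - ln s) t =[G] s).

(** [pops i t] is empty from [i = t] on, so the condition for all [i] amounts to the vanishing of
    the sum over [i < su t]. *)
Lemma unbarred_ex G F : Box G (fun G => exists B, unbarred G F B).
Proof.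
  open (fun_sum G (fun t i => delta F (pops i t)) ltac:(defT) ltac:(intros; defT)
    ltac:(intros; defT)) as [V HV].
  open (fun_def G (fun t => ap V (pJ t (su t))) ltac:(defT)) as [B HB].
  ret. exists B. intros t. world. rewrite HB. destruct (HV t) as [H0 HS]. split.
  - intros H i.
    assert (Hd : DefT (fun i => delta F (pops i t))) by defT.
    open (le_total G i t) as [Hi|Hi].
    + refine (sum_zero V _ t Hd G _ i HS H _). now apply le_SS.
    + assert (E : pops i t =[G] pops t t).
      { rewrite (pops_ge G t t (le_refl _ _)). now apply pops_ge, lt_le. }
      rewrite E. refine (sum_zero V _ t Hd G _ t HS H _). apply le_refl.
  - intros H. apply (sum_zero_intro V (fun i => delta F (pops i t)) t G); auto.
Qed.

Lemma unbarred_F F B G t : unbarred G F B -> ap B t =[G] zero -> ap F t =[G] zero.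
Proof.
  intros HU H. pose proof (proj1 (HU t G (incl_refl _)) H zero) as K.
  rewrite pops_0 in K. now apply add_eq_0 in K.
Qed.
Lemma unbarred_top F B G t : unbarred G F B -> ap B t =[G] zero -> top t <[G] two'.
Proof.
  intros HU H. pose proof (proj1 (HU t G (incl_refl _)) H zero) as K.
  rewrite pops_0 in K. rewrite sub_SS. now apply add_eq_0 in K.
Qed.
Lemma unbarred_pops F B G i t : unbarred G F B -> ap B t =[G] zero -> ap B (pops i t) =[G] zero.
Proof.
  intros HU H. apply (HU (pops i t) G (incl_refl _)). intros j. world.
  rewrite pops_add. now apply (HU t G (incl_refl _)).
Qed.
Lemma unbarred_sn F B G t x : unbarred G F B -> ap B t =[G] zero ->
  ap F (sn t x) =[G] zero -> x <[G] two' -> ap B (sn t x) =[G] zero.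
Proof.
  intros HU H HF Hx. apply (HU _ G (incl_refl _)). intros i. world.
  cases i j E; rewrite E.
  - rewrite pops_0, HF, top_sn, add_0. now rewrite sub_SS in Hx.
  - rewrite pops_sn. now apply (HU t G (incl_refl _)).
Qed.

Lemma sub_eq_S G x y z : x - y =[G] su z -> x =[G] y + su z.
Proof.
  intros H. open (le_total G y x) as [K|K].
  - rewrite <- H. now apply le_sub_add.
  - rewrite (lt_le _ _ _ K) in H. symmetry in H. eapply abs; exact H.
Qed.

(** * Extensions of a sequence *)

Lemma ext_refl G s : ext G s s.
Proof. now rewrite le_refl, pops_0. Qed.
Lemma ext_ln_le G t s : ext G t s -> ln s <=[G] ln t.
Proof. intros H. rewrite <- H at 1. rewrite ln_pops. apply sub_le. Qed.
Lemma ext_sn G t s i : ext G t (sn s i) -> ext G t s.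
Proof.
  intros H. pose proof (ext_ln_le _ _ _ H) as K. rewrite ln_sn in K.
  rewrite (sub_lt _ _ _ K), pops_S. rewrite ln_sn in H. now rewrite H, pop_sn.
Qed.
Lemma ext_cases G t s : ext G t s ->
  Box G (fun G => t =[G] s \/ exists k j, pops k t =[G] sn s j /\ ext G t (sn s j)).
Proof.
  intros H. cases (ln t - ln s) k E; rewrite E in H.
  - ret. left. now rewrite pops_0 in H.
  - ret. right. exists k, (top (pops k t)). rewrite pops_S in H.
    (* [pops k t] is one entry longer than [s], so it is the child of [s] through which [t]
       passes. *)
    assert (Hk : ln (pops k t) =[G] su (ln s)).
    { rewrite ln_pops, (sub_eq_S _ _ _ _ E), add_Sr, <- add_S. apply add_sub'. }
    apply ln_pos in Hk as [Hk _]. rewrite H in Hk. split; [exact Hk|].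
    now rewrite ln_sn, sub_Sr, E, pred_S.
Qed.

(* By induction on the length, all unbarred extensions of [s] are below [n]; stated for the
   successors of [t < n] only, to be decidable. *)
Notation finite_above G B s n := (s <[G] n /\ forall t G', incl G G' ->
  t <[G'] n -> ap B t =[G'] zero -> ext G' t s -> sn t zero <[G'] n /\ sn t one <[G'] n).

(** Each [q] is read as a pair of a sequence [pK q] and a bound [pL q]; [b] outputs [su (pK q)] if
    the bounded check succeeds, and zero, which enumerates nothing, otherwise. *)
Lemma finite_above_enum G B : Box G (fun G => exists b, forall s G', incl G G' ->
  (Eset b G' s -> Box G' (fun G => exists n, finite_above G B s n)) /\
  (forall n, finite_above G' B s n -> Eset b G' s)).
Proof.
  (* [f q t] is nonzero exactly when [t] is unbarred, extends [pK q], and one of its binary children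
     is not below [pL q]. *)
  set (f q t := C2 cond_
    (ap B t + ((pops (ln t - ln (pK q)) t - pK q) + (pK q - pops (ln t - ln (pK q)) t)))
    ((su (sn t zero) - pL q) + (su (sn t one) - pL q))).
  assert (f1 : DefT (fun y => f (pK y) (pL y))) by (unfold f; defT).
  assert (f2 : forall x, DefT (f x)) by (intros; unfold f; defT).
  assert (f3 : forall y, DefT (fun x => f x y)) by (intros; unfold f; defT).
  open (fun_sum G f f1 f2 f3) as [W HW].
  open (fun_def G (fun q => C2 cond_ (ap W (pJ q (pL q)) + (su (pK q) - pL q)) (su (pK q)))
    ltac:(defT)) as [b Hb].
  assert (P : forall G s s' n, s =[G] s' -> finite_above G B s n -> finite_above G B s' n).
  { intros G0 s s' n E [H1 H2]. split; [now rewrite <- E|]. intros t. world.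
    rewrite <- E. now apply H2, incl_refl. }
  ret. exists b. intros s. world. split.
  - intros H. open H as [q Hq]. rewrite Hb in Hq.
    cases (ap W (pJ q (pL q)) + (su (pK q) - pL q)) r E; rewrite E in Hq.
    2:{ rewrite cond_S in Hq. symmetry in Hq. apply box_false. eapply succ_neq_zero; exact Hq. }
    rewrite cond_0 in Hq. apply succ_inj in Hq. apply add_eq_0 in E as [E1 E2].
    apply (box_ret (fun G => exists n, finite_above G B s n)); [|mono].
    exists (pL q). apply (P G (pK q)); [exact Hq|]. split; [exact E2|].
    intros t. world. intros Ht HB Hext.
    pose proof (sum_zero W (f q) q (f2 q) G _ t (proj2 (HW q)) E1 Ht) as K.
    unfold f in K. rewrite HB, Hext, le_refl, add_0, add_0, cond_0 in K.
    now apply add_eq_0 in K.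
  - intros n [H1 H2]. ret. exists (pJ s n). rewrite Hb.
    assert (E : ap W (pJ (pJ s n) (pL (pJ s n))) =[G] zero).
    { apply (sum_zero_intro W (f (pJ s n)) (pJ s n) G);
        [apply (HW (pJ s n))|apply (HW (pJ s n))|].
      intros t. world. intros Ht. unfold f. rewrite L_J in Ht.
      cases (ap B t + ((pops (ln t - ln (pK (pJ s n))) t - pK (pJ s n))
        + (pK (pJ s n) - pops (ln t - ln (pK (pJ s n))) t))) z E; rewrite E.
      2: apply cond_S.
      apply add_eq_0 in E as [E E']. apply add_eq_0 in E' as [E' E''].
      pose proof (le_antisym _ _ _ E' E'') as Hext. rewrite K_J in Hext.
      destruct (H2 t G (incl_refl _) Ht E Hext) as [L1 L2].
      now rewrite cond_0, L_J, L1, L2, add_0. }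
    now rewrite E, K_J, L_J, H1, add_0, cond_0.
Qed.

Lemma finite_above_lt G F B s n t : unbarred G F B -> finite_above G B s n ->
  ext G t s -> ap B t =[G] zero -> t <[G] n.
Proof.
  intros HU [H1 H2] Hext HB.
  enough (forall k t G', incl G G' ->
    ln t =[G'] ln s + k /\ ext G' t s /\ ap B t =[G'] zero -> t <[G'] n) as H.
  { apply (H (ln t - ln s) t G (incl_refl _)). repeat split; auto.
    now apply le_sub_add, ext_ln_le. }
  clear t Hext HB. intros k. induct_with' k
    (AllN ((len #0 == Con add_ [len #2; #1]) //\
      (Con pops_ [monus (len #0) (len #2); #0] == #2) //\ (App 0 #0 == zero) ==> lt #0 #3))
    (scons s (scons n Var)) (scons B FVar).
  - intros t. world. intros [Hl [He _]]. rewrite add_0r in Hl.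
    rewrite Hl, le_refl, pops_0 in He. now rewrite He.
  - intros t. world. intros [Hl [He HB]].
    assert (Hk : ln t - ln s =[G] su k) by (rewrite Hl; apply add_sub).
    rewrite add_Sr in Hl. destruct (ln_pos _ _ _ Hl) as [E El].
    assert (HB' : ap B (pop t) =[G] zero).
    { pose proof (unbarred_pops F B G one t HU HB) as K. now rewrite pops_S, pops_0 in K. }
    assert (He' : ext G (pop t) s).
    { rewrite El, add_sub. now rewrite Hk, pops_S' in He. }
    (* The parent of [t] is an unbarred extension below [n], so its children are below [n]; [t] is
       one of them because its last entry is below two. *)
    pose proof (IH (pop t) G (incl_refl _) (conj El (conj He' HB'))) as Hlt.
    destruct (H2 (pop t) G (incl_refl _) Hlt HB' He') as [L0 L1].
    open (lt_two_cases _ _ (unbarred_top F B G t HU HB)) as [T|T];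
      rewrite E, T; assumption.
Qed.

Definition Sigma_BI G := forall F G', incl G G' ->
  Bar G' (Eset F) /\ Hered G' (Eset F) -> Eset F G' zero.

Lemma bar_induction_fan G : Sigma_BI G -> Fan G.
Proof.
  intros HS F. world. intros HF.
  open (unbarred_ex G F) as [B HU].
  open (finite_above_enum G B) as [b Hb].
  assert (HE : Eset b G zero).
  { apply HS; [apply incl_refl|]. split.
    - apply Bar_intro; [intros; mono|]. intros C g. world. intros HC P.
      open (Bar_path G _ C g HF HC P ltac:(intros; mono) (Dset_proper F)) as [m Hm].
      ret. exists m.
      (* Above a barred sequence there are no unbarred ones, so any bound exceeding its own code
         will do. *)
      apply (proj2 (Hb (ap g m) G (incl_refl _)) (su (ap g m))).
      split; [apply le_refl|]. intros t. world. intros _ HB Hext.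
      enough (prv BIM G Bot) by (split; now apply prv_botE).
      apply (Hm G (incl_refl _)). rewrite <- Hext.
      apply (unbarred_F F B); auto. apply (unbarred_pops F B); auto.
    - intros s. world. intros _. split.
      + world. intros H i. world. intros Hi.
        apply (Hb s G (incl_refl _)) in H. open H as [n [H1 H2]].
        (* If [s] is unbarred, the bound for [s] also exceeds its children and serves for them; if
           not, the child has no unbarred extensions. *)
        cases (ap B s) z E.
        * apply (proj2 (Hb (sn s i) G (incl_refl _)) n). split.
          { destruct (H2 s G (incl_refl _) H1 E (ext_refl _ _)) as [L0 L1].
            open (lt_two_cases _ _ Hi) as [A|A]; rewrite A; assumption. }
          intros t. world. intros Ht HB Hext. apply H2; auto using incl_refl.
          eapply ext_sn; exact Hext.
        * apply (proj2 (Hb (sn s i) G (incl_refl _)) (su (sn s i))).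
          split; [apply le_refl|]. intros t. world. intros _ HB Hext.
          enough (prv BIM G Bot) by (split; now apply prv_botE).
          apply ext_sn in Hext. apply (succ_neq_zero G z). rewrite <- E, <- Hext.
          apply (unbarred_pops F B); auto.
      + world. intros H.
        pose proof (H zero G (incl_refl _) (zero_lt_two _)) as A0.
        pose proof (H one G (incl_refl _) (one_lt_two _)) as A1.
        apply (Hb _ G (incl_refl _)) in A0. apply (Hb _ G (incl_refl _)) in A1.
        clear H. open A0 as [n0 A0]. open A1 as [n1 A1].
        (* This sum exceeds [s] and dominates the bounds of both children. *)
        apply (proj2 (Hb s G (incl_refl _)) (su s + (n0 + n1))).
        assert (L0 : forall (G : ctx) x, x <=[G] n0 -> x <=[G] su s + (n0 + n1)).
        { intros ? x Hx. apply le_add_mono', le_add_mono, Hx. }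
        assert (L1 : forall (G : ctx) x, x <=[G] n1 -> x <=[G] su s + (n0 + n1)).
        { intros ? x Hx. apply le_add_mono', le_add_mono', Hx. }
        split; [apply le_add|]. intros t. world. intros _ HB Hext.
        (* The case distinction on [t] proves both inequalities inside one [Box], which is then
           opened once for each of them. *)
        enough (Box G (fun G => sn t zero <[G] su s + (n0 + n1) /\
                                sn t one <[G] su s + (n0 + n1))) as K.
        { split; open K as [K0 K1]; assumption. }
        open (ext_cases _ _ _ Hext) as [Ht|[k [j [Hk Hj]]]].
        * ret. rewrite Ht. split; [apply L0, (proj1 A0)|apply L1, (proj1 A1)].
        * assert (Tj : j <[G] two').
          { rewrite <- (top_sn G s j), <- Hk.
            apply (unbarred_top F B); auto. apply (unbarred_pops F B); auto. }
          open (lt_two_cases _ _ Tj) as [T|T]; rewrite T in Hj; ret.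
          -- destruct (proj2 A0 t G (incl_refl _)
               (finite_above_lt G F B _ _ _ HU A0 Hj HB) HB Hj). split; now apply L0.
          -- destruct (proj2 A1 t G (incl_refl _)
               (finite_above_lt G F B _ _ _ HU A1 Hj HB) HB Hj). split; now apply L1. }
  apply (Hb zero G (incl_refl _)) in HE. open HE as [n Hn].
  open (path_ex G F) as [h Ph].
  (* As [n] exceeds all unbarred codes, values of [F] below [n] suffice to bar every path. *)
  apply box_ret; [exists n|mono]. apply box_ret; [exists (ap h n)|mono].
  split; [now apply path_init|].
  apply Bar_intro; [intros; mono|]. intros C g. world. intros HC P.
  intros G' A Hi HA. lift Hi.
  (* The goal [Box] has been unfolded: [A] is its arbitrary conclusion, derivable as soon as a
     segment of the path with code below [n] is in the bar. *)
  assert (HA' : forall m G', incl G G' -> ap g m <[G'] n ->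
    nz G' (ap F (ap g m)) -> prv BIM G' A).
  { intros m. world. intros H1 H2. apply HA; [apply incl_refl|]. exists m.
    split; [now rewrite (path_ln _ _ _ _ Ph)|].
    refine (nz_proper _ _ _ _ H2). symmetry. now apply (path_en _ _ _ _ _ Ph). }
  clear HA.
  (* Following the path, either a segment in the bar has been met with its code below [n], or the
     current segment is still unbarred and below [n]. *)
  assert (H : forall m, Box G (fun G => prv BIM G A \/
    (ap B (ap g m) =[G] zero /\ ap g m <[G] n))).
  { intros m. induct m.
    - assert (H0 : ap g zero <[G] n) by (rewrite (proj1 P); apply Hn).
      cases (ap F (ap g zero)) z E.
      + ret. right. split; [|exact H0]. rewrite (proj1 P) in E |- *.
        apply (HU zero G (incl_refl _)). intros i. world.
        now rewrite pops_nil, E, top_0, sub_0l, add_0.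
      + ret. left. apply (HA' _ G (incl_refl _) H0). now apply pos_nz with z.
    - open IH as [IH|[HB Hlt]]; [ret; auto|].
      destruct (proj2 Hn (ap g m) G (incl_refl _) Hlt HB) as [L0 L1].
      { now rewrite ln_0, sub_0r, pops_ln. }
      assert (Hlt' : ap g (su m) <[G] n).
      { rewrite (proj2 P). open (lt_two_cases _ _ (HC m)) as [T|T]; rewrite T; assumption. }
      cases (ap F (ap g (su m))) z E.
      + ret. right. split; [|exact Hlt']. rewrite (proj2 P) in E |- *.
        apply (unbarred_sn F B); auto.
      + ret. left. apply (HA' _ G (incl_refl _) Hlt'). now apply pos_nz with z. }
  (* The segment of length [n] has code at least [n], which excludes the second alternative. *)
  open (H n) as [K|[_ K]]; [exact K|].
  apply prv_botE. apply (le_lt_false G n (ap g n)); [now apply (path_le C g)|exact K].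
Qed.

Theorem theorem3p1 :
  (BIM |-- Dec_BI_C) /\ (BIM |-- (Sigma01_BI_C <==> FT)).
Proof.
  split; apply sat_closed.
  - intros F G _ [HB HH]. exact (dec_bar_induction G F HB HH).
  - split.
    + intros G _ HS. exact (bar_induction_fan G HS).
    + intros G _ HF F G' Hi [HB HH].
      apply (fan_bar_induction G' F); auto.
      intros H G1 Hi1. apply HF. eapply incl_tran; eauto.
Qed.
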